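(* Let $M$ be a positive integer and let $\vec{p}=(p_1,\ldots,p_M)\in(0,1)^M$ and $\vec{q}=(q_1,\ldots,q_M)\in(0,1)^M$ be cookie environments. If $\vec{p}\prec\vec{q}$ and $\delta(\vec{p})>1$, then $$P_{\vec{p}}\left(X_n>0 \text{ for all } n>0\right) < P_{\vec{q}}\left(X_n>0 \text{ for all } n>0\right).$$
   Context: Excited random walk. For a positive integer $M$ and a cookie environment $\vec{p}=(p_1,\ldots,p_M)\in(0,1)^M$, the excited random walk $\{X_n\}_{n\ge 0}$ is the $\mathbb{Z}$-valued nearest-neighbor process with law $P_{\vec{p}}$ given by $P_{\vec{p}}(X_0=0)=1$ and, with $\mathcal{F}_n=\sigma(X_k,\ k\le n)$, $$P_{\vec{p}}(X_{n+1}=X_n+1\mid\mathcal{F}_n)=1-P_{\vec{p}}(X_{n+1}=X_n-1\mid\mathcal{F}_n)=\begin{cases}p_j & \text{if } \#\{k\le n: X_k=X_n\}=j \text{ with } 1\le j\le M,\\ 1/2 & \text{if } \#\{k\le n: X_k=X_n\}>M.\end{cases}$$ Total drift. $\delta(\vec{p})=\sum_{j=1}^M(2p_j-1)$. Partial ordering. For $\vec{p},\vec{q}\in(0,1)^M$ we write $\vec{p}\preccurlyeq\vec{q}$ if there exists a coupling $\mathbf{P}$ of random vectors $\mathbf{Y}=(Y_1,\ldots,Y_M)$ and $\mathbf{Z}=(Z_1,\ldots,Z_M)$ such that: (i) $Y_1,\ldots,Y_M$ are independent Bernoulli random variables with $Y_j\sim\mathrm{Ber}(p_j)$; (ii) $Z_1,\ldots,Z_M$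 are independent Bernoulli random variables with $Z_j\sim\mathrm{Ber}(q_j)$; (iii) $\mathbf{P}\left(\sum_{j=1}^m Y_j\le\sum_{j=1}^m Z_j\right)=1$ for every $m=1,\ldots,M$. (No independence between $\mathbf{Y}$ and $\mathbf{Z}$ is required.) We write $\vec{p}\prec\vec{q}$ if there is such a coupling for which, moreover, $\mathbf{P}\left(\sum_{j=1}^m Y_j<\sum_{j=1}^m Z_j\right)>0$ for some $m\le M$. *)

(* Defs.v *)
From HB Require Import structures.
From mathcomp Require Import all_boot all_order all_algebra.
From mathcomp Require Import all_classical all_reals all_analysis.

Set Implicit Arguments.
Unset Strict Implicit.
Unset Printing Implicit Defensive.

Import Order.TTheory GRing.Theory Num.Theory.

Local Open Scope classical_set_scope.
Local Open Scope ring_scope.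

HB.instance Definition _ := isPointed.Build int 0.

HB.instance Definition _ := @isMeasurable.Build default_measure_display
  int discrete_measurable discrete_measurable0
  discrete_measurableC discrete_measurableU.

Section probability_notions.
Context (R : realType) (d : measure_display) (T : measurableType d).
Variable P : probability T R.

(* Kolmogorov's definition: f is a version of P(E | F). Integrability of f
   follows from the second clause with A = setT. *)
Definition is_cond_prob (F : set_system T) (E : set T) (f : T -> R) : Prop :=
  (forall B : set R, measurable B -> F (f @^-1` B)) /\
  (forall A : set T, F A -> P (A `&` E) = (\int[P]_(w in A) (f w)%:E)%E).

Definition mutually_independent (d' : measure_display)
    (T' : measurableType d') (I : finType) (Y : I -> {RV P >-> T'}) : Prop :=
  forall (J : {set I}) (B : I -> set T'), (forall i, measurable (B i)) ->
  P (\bigcap_(i in [set i | i \in J]) (Y i @^-1` B i)) =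
  (\prod_(i in J) P (Y i @^-1` B i))%E.

Definition independent_bernoulli (M : nat) (p : M.-tuple R)
    (Y : 'I_M -> {RV P >-> bool}) : Prop :=
  mutually_independent Y /\
  forall j : 'I_M, distribution P (Y j) =1 bernoulli_prob (tnth p j).

End probability_notions.

Section excited_random_walk.
Context (R : realType) (M : nat).
Implicit Types p q : M.-tuple R.

Definition cookie_env p : Prop := forall j : 'I_M, 0 < tnth p j < 1.

Definition total_drift p : R := \sum_(j < M) (2 * tnth p j - 1).

(* Probability of a right step at the j-th visit (j >= 1) to a site: tuples
   are indexed from 0, and the default value of nth covers j > M. *)
Definition cookie p (j : nat) : R := nth 2^-1 p j.-1.

(* Number of visits to the current site up to and including time n, hence
   always at least 1. *)
Definition visits (T : Type) (X : nat -> T -> int) (n : nat) (w : T) : nat :=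
  #|[pred k : 'I_n.+1 | X k w == X n w]|.

Definition natural_filtration (d : measure_display) (T : measurableType d)
    (X : nat -> T -> int) (n : nat) : set_system T :=
  g_sigma_preimage (fun k : 'I_n.+1 => X k).

(* X has the law P_p; any probability space carrying such a process will do,
   since the law of the whole path is determined. *)
Definition is_ERW (d : measure_display) (T : measurableType d)
    (P : probability T R) p (X : nat -> {RV P >-> int}) : Prop :=
  P [set w | X 0%N w = 0] = 1%E /\
  forall n : nat,
    is_cond_prob P (natural_filtration X n) [set w | X n.+1 w = X n w + 1]
      (fun w => cookie p (visits X n w)) /\
    is_cond_prob P (natural_filtration X n) [set w | X n.+1 w = X n w - 1]
      (fun w => 1 - cookie p (visits X n w)).

(* Y_1 + ... + Y_m, with Y_j stored at index j - 1. *)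
Definition partial_sum (T : Type) (Y : 'I_M -> T -> bool) (m : nat) (w : T)
    : nat := (\sum_(j < M | (j < m)%N) Y j w)%N.

Definition is_coupling (d : measure_display) (T : measurableType d)
    (P : probability T R) p q (Y Z : 'I_M -> {RV P >-> bool}) : Prop :=
  [/\ independent_bernoulli p Y,
      independent_bernoulli q Z &
      forall m : nat, (1 <= m <= M)%N ->
        P [set w | (partial_sum Y m w <= partial_sum Z m w)%N] = 1%E].

Definition env_lt p q : Prop :=
  exists (d : measure_display) (T : measurableType d) (P : probability T R)
    (Y Z : 'I_M -> {RV P >-> bool}),
    is_coupling p q Y Z /\
    exists2 m : nat, (1 <= m <= M)%N &
      (0 < P [set w | (partial_sum Y m w < partial_sum Z m w)%N])%E.

End excited_random_walk.

(* Main.v *)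
Require Import Defs.
From mathcomp Require Import all_boot all_order all_algebra.
From mathcomp Require Import all_classical all_reals all_analysis.
From mathcomp Require Import ring lra zify.
Import Order.TTheory GRing.Theory Num.Theory numFieldNormedType.Exports.
Local Open Scope classical_set_scope.
Local Open Scope ring_scope.

Set Implicit Arguments.
Unset Strict Implicit.
Unset Printing Implicit Defensive.

(** The walk is compared with a branching process.  Read the coins of each site
    k >= 1, cookies first, as its successive steps, and let V_k be the number of
    right steps at k before its V_{k-1}-th left step, with V_0 = 1.  The walk
    started at 1 returns to 0 if and only if V dies out, up to null sets, so the
    probability of never returning is p_1 times the survival probability of V.
    Here [offspring l f m] is the mean of f (V_k) given V_{k-1} = m, and
    [surv l n v] is the probability that V, started from v, is alive after n
    generations.  Three facts give the theorem.

    - For m >= M the mean of V_k given V_{k-1} = m is m + delta, and the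
      variance is close to 2m, so that V behaves like a squared Bessel process of
      dimension 2 delta, which survives with positive probability when
      delta > 1 ([surv_bounded_below]).  The functions (1 - 1/t)^v of v are
      mapped to multiples of (1 - 1/(t+1))^v ([offspring_exp]), and a
      combination of them with weights of order t^-delta is a Lyapunov function.

    - The number of right steps before the m-th left step increases when the
      partial sums of the coins increase ([offspring_coins_le]), and for some m
      it increases strictly with positive probability under the coupling
      ([joint_offspring_gap]).  The survival probability increases strictly with
      the number of individuals ([offspring_incr]), hence it is strictly larger
      for q than for p ([surv_gap]).

    - The conditional probability, given the past of the walk, that the
      branching process is alive after r sites is a harmonic function of the
      current state ([escape], [escape_harmonic]).  It bounds the probability of staying
      positive for n steps from below when n is small compared with r
      ([escape_le_stay]), and from above up to the probability of lingering in
      a finite window, which decays exponentially with n ([stay_le_escape]).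

    The gap between the survival probabilities is bounded below uniformly in the
    number of generations, so it persists in the limit and no limit is ever
    exchanged with the transition operator. *)

(** * The transition operator of the branching process *)

Section offspring.
Context {R : realType}.
Implicit Types (f g : nat -> R) (l : seq R) (a b : R) (v m n : nat).

Definition bounded_seq f := exists B : R, forall v, `|f v| <= B.

(** The mean of f (v + G), where G is the number of right steps before the next
    left step of a site without cookies, so that G = i with probability
    2^-(i+1). *)
Definition geom_avg f v : R :=
  limn (series (fun i => 2^-1 ^+ i.+1 * f (v + i)%N)).

Lemma is_cvg_geom_avg f v : bounded_seq f ->
  cvgn (series (fun i => 2^-1 ^+ i.+1 * f (v + i)%N)).
Proof.
move=> [B hB]; apply: normed_cvg.
have B0 : 0 <= B := le_trans (normr_ge0 _) (hB 0%N).
apply: (@series_le_cvg _ _ (geometric (B * 2^-1) 2^-1)) => [n|n|n|].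
- exact: normr_ge0.
- by rewrite /= mulr_ge0// ?mulr_ge0 ?exprn_ge0// invr_ge0.
- rewrite /= normrM ger0_norm ?exprn_ge0 ?invr_ge0// exprS mulrC -mulrA.
  by rewrite ler_wpM2r// ?mulr_ge0 ?exprn_ge0 ?invr_ge0.
- by apply: is_cvg_geometric_series; rewrite ger0_norm ?invr_ge0//; lra.
Qed.

Lemma bounded_shift f e : bounded_seq f -> bounded_seq (fun v => f (v + e)%N).
Proof. by move=> [B hB]; exists B. Qed.

Lemma bounded_lin a b f g : bounded_seq f -> bounded_seq g ->
  bounded_seq (fun v => a * f v + b * g v).
Proof.
move=> [B hB] [C hC]; exists (`|a| * B + `|b| * C) => v.
rewrite (le_trans (ler_normD _ _))// !normrM.
by rewrite lerD// ler_wpM2l.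
Qed.

Lemma bounded_unit f : (forall v, 0 <= f v <= 1) -> bounded_seq f.
Proof. by move=> h; exists 1 => v; rewrite ger0_norm; case/andP: (h v). Qed.

(** Condition on the first fair coin. *)
Lemma geom_avgE f v : bounded_seq f ->
  geom_avg f v = 2^-1 * f v + 2^-1 * geom_avg f v.+1.
Proof.
move=> bf; apply/cvg_lim => //; rewrite -(cvg_shiftS _) /=.
rewrite [X in X @ _ --> _](_ : _ = fun n => 2^-1 * f v +
    2^-1 * series (fun i => 2^-1 ^+ i.+1 * f (v.+1 + i)%N) n).
  by apply: cvgD; [exact: cvg_cst|apply: cvgMr; exact: is_cvg_geom_avg].
apply/funext => n; rewrite /series /= big_nat_recl//= addn0 expr1; congr +%R.
by rewrite mulr_sumr; apply: eq_bigr => i _; rewrite exprS -mulrA addSnnS.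
Qed.

Lemma geom_avg_lin a b f g v : bounded_seq f -> bounded_seq g ->
  geom_avg (fun v => a * f v + b * g v) v = a * geom_avg f v + b * geom_avg g v.
Proof.
move=> bf bg; apply/cvg_lim => //.
rewrite [X in X @ _ --> _](_ : _ = fun n =>
    a * series (fun i => 2^-1 ^+ i.+1 * f (v + i)%N) n +
    b * series (fun i => 2^-1 ^+ i.+1 * g (v + i)%N) n).
  by apply: cvgD; apply: cvgMr; exact: is_cvg_geom_avg.
apply/funext => n; rewrite /series /= !mulr_sumr -big_split; apply: eq_bigr => i _.
by rewrite /=; ring.
Qed.

Lemma geom_avg_shift f e v :
  geom_avg (fun v => f (v + e)%N) v = geom_avg f (v + e)%N.
Proof.
rewrite /geom_avg; congr (limn (series _)); apply/funext => i.
by rewrite addnAC.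
Qed.

Lemma le_geom_avg f g v : bounded_seq f -> bounded_seq g ->
  (forall i, f (v + i)%N <= g (v + i)%N) -> geom_avg f v <= geom_avg g v.
Proof.
move=> bf bg fg; apply: lim_series_le; try exact: is_cvg_geom_avg.
by move=> n; rewrite ler_wpM2l// exprn_ge0// invr_ge0.
Qed.

(** By homogeneity the average of an exponential is a multiple of it, and
    conditioning on the first coin determines the factor. *)
Lemma geom_avg_exp (s : R) v : 0 <= s <= 1 ->
  geom_avg (fun v => s ^+ v) v = s ^+ v / (2 - s).
Proof.
move=> hs; have bs : bounded_seq (fun v => s ^+ v).
  by apply: bounded_unit => n; rewrite exprn_ge0 ?exprn_ile1//; case/andP: hs.
have E n : geom_avg (fun v => s ^+ v) n = s ^+ n * geom_avg (fun v => s ^+ v) 0.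
  have := @geom_avg_lin (s ^+ n) 0 _ _ 0%N bs bs; rewrite mul0r addr0 => <-.
  rewrite -(add0n n) -geom_avg_shift add0n; congr (geom_avg _ _).
  by apply/funext => k; rewrite mul0r addr0 exprD mulrC.
have := geom_avgE 0%N bs; rewrite (E 1%N) (E v) expr0 expr1.
set G := geom_avg _ _ => h; congr (_ * _).
have s2 : 2 - s != 0 by rewrite gt_eqF//; case/andP: hs => _ ?; lra.
by apply: (mulIf s2); rewrite mulVf//; lra.
Qed.

Lemma geom_avg_cst a v : geom_avg (fun=> a) v = a.
Proof.
have b1 : bounded_seq (fun v => 1 ^+ v) by exists 1 => n; rewrite expr1n normr1.
have := @geom_avg_lin a 0 _ _ v b1 b1; rewrite geom_avg_exp ?ler01 ?lexx//.
rewrite expr1n mul0r addr0 mul1r (_ : 2 - 1 = 1 :> R); last by ring.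
rewrite invr1 mulr1 => {2}<-; congr (geom_avg _ _); apply/funext => n.
by rewrite expr1n mulr1 mul0r addr0.
Qed.

Lemma bounded_geom_avg f : bounded_seq f -> bounded_seq (geom_avg f).
Proof.
move=> [B hB]; exists B => v.
have bf : bounded_seq f by exists B.
have bc a : bounded_seq (fun=> a) by exists `|a|.
have le_f i : - B <= f i <= B by rewrite -ler_norml.
rewrite ler_norml; apply/andP; split.
  rewrite -(geom_avg_cst (- B) v); apply: le_geom_avg => // i.
  by case/andP: (le_f (v + i)%N).
rewrite -[leRHS](geom_avg_cst B v); apply: le_geom_avg => // i.
by case/andP: (le_f (v + i)%N).
Qed.

Definition nondecr f := forall v, f v <= f v.+1.

Lemma nondecrW f v w : nondecr f -> (v <= w)%N -> f v <= f w.
Proof.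
move=> ndf; elim: w => [|w IH]; first by rewrite leqn0 => /eqP->.
by rewrite leq_eqVlt => /predU1P[->//|/IH /le_trans]; apply.
Qed.

Lemma nondecr_geom_avg f : bounded_seq f -> nondecr f -> nondecr (geom_avg f).
Proof.
move=> bf ndf v; rewrite -addn1 -geom_avg_shift.
apply: le_geom_avg => //; first exact: bounded_shift.
by move=> i; rewrite addn1.
Qed.

Lemma ge_geom_avg f v : bounded_seq f -> nondecr f -> f v <= geom_avg f v.
Proof.
move=> bf ndf; rewrite -{1}(geom_avg_cst (f v) v); apply: le_geom_avg => //.
  by exists `|f v|.
by move=> i; apply: nondecrW => //; exact: leq_addr.
Qed.

(** The mean of f (S), where S is the number of right steps of a site before
    its m-th left step, l being the cookies left there.  A fair site
    contributes one independent geometric variable for each left step. *)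
Fixpoint offspring l f m : R :=
  match l, m with
  | nil, _ => iter m geom_avg f 0%N
  | a :: l', m'.+1 =>
      a * offspring l' (fun v => f v.+1) m + (1 - a) * offspring l' f m'
  | _ :: _, 0%N => f 0%N
  end.

Lemma bounded_iter m f : bounded_seq f -> bounded_seq (iter m geom_avg f).
Proof. by elim: m => //= m IH /IH; exact: bounded_geom_avg. Qed.

Lemma bounded_S f : bounded_seq f -> bounded_seq (fun v => f v.+1).
Proof. by move=> /(bounded_shift 1) [B hB]; exists B => v; rewrite -addn1. Qed.

Lemma iter_geom_avg_shift m f e v :
  iter m geom_avg (fun v => f (v + e)%N) v = iter m geom_avg f (v + e)%N.
Proof.
elim: m v => //= m IH v; rewrite -geom_avg_shift; congr (geom_avg _ _).
exact/funext.
Qed.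

Lemma offspring0 l f : offspring l f 0 = f 0%N.
Proof. by case: l. Qed.

Lemma offspring_nilS f m : bounded_seq f -> offspring nil f m.+1 =
  2^-1 * offspring nil (fun v => f v.+1) m.+1 + (1 - 2^-1) * offspring nil f m.
Proof.
move=> bf /=; rewrite geom_avgE; last exact: bounded_iter.
rewrite addrC; congr (_ * _ + _ * _); last by lra.
rewrite -(add0n 1%N) -geom_avg_shift; congr (geom_avg _ _); apply/funext => v.
rewrite -iter_geom_avg_shift; congr (iter _ _ _ _).
by apply/funext => w; rewrite addn1.
Qed.

(** Read one coin, whether or not a cookie is left: the default value 2^-1 of
    [nth] is the fair coin. *)
Lemma offspring_drop l c f m : bounded_seq f -> offspring (drop c l) f m.+1 =
  nth 2^-1 l c * offspring (drop c.+1 l) (fun v => f v.+1) m.+1 +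
  (1 - nth 2^-1 l c) * offspring (drop c.+1 l) f m.
Proof.
move=> bf; case: (ltnP c (size l)) => h; first by rewrite (drop_nth 2^-1 h).
by rewrite !drop_oversize ?nth_default// ?(leqW h)//; exact: offspring_nilS.
Qed.

Lemma offspring_lin l a b f g m : bounded_seq f -> bounded_seq g ->
  offspring l (fun v => a * f v + b * g v) m =
  a * offspring l f m + b * offspring l g m.
Proof.
elim: l f g m => [|c l IH] f g m bf bg /=.
  move: 0%N; elim: m => // m IH n /=; rewrite -geom_avg_lin.
  - congr (geom_avg _ _); exact/funext.
  - exact: bounded_iter.
  - exact: bounded_iter.
case: m => // m; rewrite !IH//; [ring|exact: bounded_S..].
Qed.

End offspring.

(** * Order properties and generating functions *)

Section offspring_order.
Context {R : realType}.
Implicit Types (f g : nat -> R) (l : seq R) (a b : R) (v m n : nat).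

Definition in01 := all (fun a : R => 0 <= a <= 1).

Lemma le_offspring l f g m : in01 l -> bounded_seq f -> bounded_seq g ->
  (forall v, f v <= g v) -> offspring l f m <= offspring l g m.
Proof.
elim: l f g m => [|a l IH] f g m /=.
  move=> _ bf bg fg; move: 0%N; elim: m => //= m IH n.
  by apply: le_geom_avg => //; exact: bounded_iter.
case: m => // m /andP[/andP[a0 a1] l01] bf bg fg.
by rewrite lerD ?ler_wpM2l ?subr_ge0 ?IH//; exact: bounded_S.
Qed.

Lemma offspring_cst l a m : offspring l (fun=> a) m = a.
Proof.
elim: l m => [|b l IH] [|m] //=.
  rewrite -[RHS](geom_avg_cst a 0); congr (geom_avg _ _).
  elim: m => //= k ->; apply/funext => n; exact: geom_avg_cst.
by rewrite !IH; ring.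
Qed.

Lemma offspring01 l f m : in01 l -> (forall v, 0 <= f v <= 1) ->
  0 <= offspring l f m <= 1.
Proof.
move=> l01 f01; have bf := bounded_unit f01.
have bc a : bounded_seq (fun=> a) by exists `|a|.
apply/andP; split; first rewrite -(offspring_cst l 0 m).
  by apply: le_offspring => // v; case/andP: (f01 v).
rewrite -[leRHS](offspring_cst l 1 m).
by apply: le_offspring => // v; case/andP: (f01 v).
Qed.

Lemma offspring_ge l f m a : in01 l -> bounded_seq f ->
  (forall v, a <= f v) -> a <= offspring l f m.
Proof.
move=> l01 bf af; rewrite -(offspring_cst l a m); apply: le_offspring => //.
by exists `|a|.
Qed.

Lemma nondecr_S f : nondecr f -> nondecr (fun v => f v.+1).
Proof. by move=> ndf v. Qed.

Lemma iter_geom_avg_nondecr m f : bounded_seq f -> nondecr f ->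
  nondecr (iter m geom_avg f).
Proof.
move=> bf ndf; elim: m => //= m IH.
by apply: nondecr_geom_avg => //; exact: bounded_iter.
Qed.

(** Waiting for one more left step can only add right steps. *)
Lemma nondecr_offspring l f : in01 l -> bounded_seq f -> nondecr f ->
  nondecr (offspring l f).
Proof.
elim: l f => [|a l IH] f /=.
  move=> _ bf ndf m /=; apply: ge_geom_avg; first exact: bounded_iter.
  exact: iter_geom_avg_nondecr.
move=> /andP[/andP[a0 a1] l01] bf ndf [|m].
  have : f 0%N <= offspring l (fun v => f v.+1) 1.
    by apply: offspring_ge => [//||v]; [exact: bounded_S|exact: nondecrW].
  by rewrite offspring0 => f0; nra.
rewrite lerD ?ler_wpM2l ?subr_ge0 ?IH//; exact: bounded_S || exact: nondecr_S.
Qed.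

(** Uniform ellipticity: both steps have probability at least e. *)
Definition elliptic (e : R) := all (fun a : R => e <= a <= 1 - e).

Lemma elliptic_nth (e : R) l c : e <= 2^-1 -> elliptic e l ->
  e <= nth 2^-1 l c <= 1 - e.
Proof.
move=> eh el; case: (ltnP c (size l)) => h; first exact: (all_nthP _ el).
by rewrite nth_default// eh; lra.
Qed.

Lemma elliptic_drop (e : R) l c : elliptic e l -> elliptic e (drop c l).
Proof. by move=> el; apply/allP => x /mem_drop /(allP el). Qed.

Lemma elliptic_in01 (e : R) l : 0 <= e -> elliptic e l -> in01 l.
Proof.
by move=> e0 el; apply/allP => x /(allP el) /andP[? ?]; apply/andP; split; lra.
Qed.

(** With probability at least e^(m+1) the coins start with m left steps and one
    right step; then there is no right step before the m-th left step, and at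
    least one before the next left step. *)
Lemma offspring_incr l f m (e : R) : 0 <= e <= 2^-1 -> elliptic e l ->
  bounded_seq f -> nondecr f ->
  e ^+ m.+1 * (f 1%N - f 0%N) <= offspring l f m.+1 - offspring l f m.
Proof.
move=> /andP[e0 eh]; elim: m l f => [|m IH] l f el bf ndf.
  rewrite expr1 offspring0 -(drop0 l) offspring_drop// offspring0.
  have /andP[] := elliptic_nth 0 eh el; set a := nth _ _ _ => ea ae.
  have : f 1%N <= offspring (drop 1 l) (fun v => f v.+1) 1.
    apply: offspring_ge; last by move=> v; exact: nondecrW.
    + exact/(elliptic_in01 e0)/elliptic_drop.
    + exact: bounded_S.
  have := ndf 0%N; move: (offspring _ _ _) (f 0%N) (f 1%N) => X x y xy yX.
  have : e * (y - x) <= a * (X - x) by rewrite ler_pM ?subr_ge0 ?lerD2r.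
  lra.
rewrite -(drop0 l) !(@offspring_drop _ l 0)//.
have /andP[] := elliptic_nth 0 eh el; set a := nth _ _ _ => ea ae.
have el1 := elliptic_drop 1 el.
have h2 := IH _ _ el1 bf ndf.
have : offspring (drop 1 l) (fun v => f v.+1) m.+1
   <= offspring (drop 1 l) (fun v => f v.+1) m.+2.
  apply: nondecr_offspring; last exact: nondecr_S.
  + exact: elliptic_in01 e0 el1.
  + exact: bounded_S.
move: h2 (ndf 0%N); move: (offspring _ _ _) (offspring _ _ _) => B A h2 f01.
move: (offspring _ _ _) (offspring _ _ _) => D C CD.
have h3 : e ^+ m.+2 * (f 1%N - f 0%N) <= e * (A - B).
  by rewrite exprS -mulrA ler_wpM2l.
have AB : 0 <= A - B.
  by rewrite (le_trans _ h2)// mulr_ge0 ?exprn_ge0// subr_ge0.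
have : e * (A - B) <= (1 - a) * (A - B) by rewrite ler_wpM2r//; lra.
have : 0 <= a * (D - C) by rewrite mulr_ge0//; lra.
lra.
Qed.

(** With probability at least e^(v+1) the coins start with exactly v right
    steps followed by a left step. *)
Lemma offspring1_ge l f v (e : R) : 0 <= e <= 2^-1 -> elliptic e l ->
  bounded_seq f -> (forall v, 0 <= f v) ->
  e ^+ v.+1 * f v <= offspring l f 1.
Proof.
move=> /andP[e0 eh]; elim: v l f => [|v IH] l f el bf f0.
all: rewrite -(drop0 l) offspring_drop// offspring0.
all: have /andP[] := elliptic_nth 0 eh el; set a := nth _ _ _ => ea ae.
all: have el1 := elliptic_drop 1 el; have l1 := elliptic_in01 e0 el1.
  have : 0 <= offspring (drop 1 l) (fun v => f v.+1) 1.
    by apply: offspring_ge => //; exact: bounded_S.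
  have := f0 0%N; move: (offspring _ _ _) (f 0%N) => X x x0 X0; rewrite expr1.
  have : e * x <= (1 - a) * x by rewrite ler_wpM2r//; lra.
  by have : 0 <= a * X by [rewrite mulr_ge0//; lra]; lra.
have := IH _ _ el1 (bounded_S bf) (fun v => f0 v.+1).
move: (f0 0%N) (f0 v.+1); move: (offspring _ _ _) (f 0%N) (f v.+1).
move=> C x y x0 y0 h.
have : e ^+ v.+2 * y <= a * C.
  by rewrite exprS -mulrA ler_pM// mulr_ge0 ?exprn_ge0.
have : 0 <= (1 - a) * x by rewrite mulr_ge0//; lra.
lra.
Qed.

(** With s = 1 - 1/t, a fair site turns s^v into a multiple of (1/(2-s))^m, and
    1/(2-s) = 1 - 1/(t+1): the parameter t moves by one in each generation.
    When m is at least the number of cookies, all cookies are read by the time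
    of the m-th left step, and each of them contributes one factor. *)
Lemma offspring_exp l (t : R) m : 1 <= t -> (size l <= m)%N ->
  offspring l (fun v => (1 - t^-1) ^+ v) m =
  (1 - (t + 1)^-1) ^+ m * \prod_(a <- l) (1 - (2 * a - 1) / t).
Proof.
move=> t1; have t0 : t != 0 by rewrite gt_eqF//; lra.
have t10 : t + 1 != 0 by rewrite gt_eqF//; lra.
have s01 : 0 <= 1 - t^-1 <= 1.
  have : 0 < t^-1 by rewrite invr_gt0; lra.
  have : t^-1 <= 1 by rewrite invf_le1; lra.
  by move=> ? ?; apply/andP; split; lra.
have bs : bounded_seq (fun v => (1 - t^-1) ^+ v).
  by apply: bounded_unit => n; rewrite exprn_ge0 ?exprn_ile1//; case/andP: s01.
elim: l m => [m _|a l IH [//|m]] /=.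
  rewrite big_nil mulr1.
  have E k n : iter k geom_avg (fun v => (1 - t^-1) ^+ v) n =
      (1 - (t + 1)^-1) ^+ k * (1 - t^-1) ^+ n.
    elim: k n => [n|k IH n] /=; first by rewrite expr0 mul1r.
    have -> : iter k geom_avg (fun v => (1 - t^-1) ^+ v) =
        fun n => (1 - (t + 1)^-1) ^+ k * (1 - t^-1) ^+ n + 0 * (1 - t^-1) ^+ n.
      by apply/funext => i; rewrite IH mul0r addr0.
    rewrite geom_avg_lin// mul0r addr0 geom_avg_exp// exprS.
    by field; rewrite t0 t10; apply/andP; split => //; rewrite gt_eqF//; lra.
  by rewrite E expr0 mulr1.
rewrite ltnS => lm; rewrite IH// big_cons.
have -> : (fun v => (1 - t^-1) ^+ v.+1) =
    fun v => (1 - t^-1) * (1 - t^-1) ^+ v + 0 * (1 - t^-1) ^+ v.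
  by apply/funext => i; rewrite mul0r addr0 exprS.
rewrite offspring_lin// mul0r addr0 IH ?(leqW lm)// exprS.
by field; rewrite t0 t10.
Qed.

End offspring_order.

(** * Prescribed coins and the domination of partial sums *)

Section coin_sequences.
Context {R : realType}.
Implicit Types (f : nat -> R) (y z : seq bool) (m k e : nat).

(** A prescribed sequence of coins is a list of cookies with values 0 and 1, to
    which [offspring] applies. *)
Definition coins y : seq R := [seq (nat_of_bool b)%:R | b <- y].

Lemma coins_in01 y : in01 (coins y).
Proof. by apply/allP => x /mapP[[] _ ->]; rewrite ?lexx ?ler01. Qed.

Lemma offspring_coin (b : bool) y f m : offspring (coins (b :: y)) f m.+1 =
  if b then offspring (coins y) (fun v => f v.+1) m.+1
  else offspring (coins y) f m.
Proof. by case: b => /=; rewrite ?subrr ?subr0 !mul1r !mul0r ?addr0 ?add0r. Qed.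

(** The offset e is the lead of z over y in right steps.  After the same number
    of coins z has e fewer left steps, so that it has to wait for e more of
    them; this invariant is what the induction on the coins propagates. *)
Lemma offspring_coins_le y z e f m : bounded_seq f -> nondecr f ->
  size y = size z ->
  (forall k, (count id (take k y) <= count id (take k z) + e)%N) ->
  offspring (coins y) f m <=
  offspring (coins z) (fun v => f (v + e)%N) (m + e)%N.
Proof.
elim: y z e f m => [|b y IH] [|c z] e f m bf ndf //.
  move=> _ _; apply: (@le_trans _ _ (offspring nil f (m + e)%N)).
    apply: (@nondecrW _ (offspring nil f) m); last exact: leq_addr.
    exact: nondecr_offspring.
  apply: (@le_offspring _ nil) => // [|v /=]; first exact: bounded_shift.
  by apply: nondecrW => //; exact: leq_addr.
move=> [yz] h; case: m => [|m].
  rewrite add0n offspring0; apply: offspring_ge => [||v /=].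
  - exact: (coins_in01 (c :: z)).
  - exact: bounded_shift.
  - by apply: nondecrW.
rewrite addSn offspring_coin (offspring_coin c).
have bS := bounded_S bf; have nS := nondecr_S ndf.
case: b c h => -[] h.
- have := IH z e _ m.+1 bS nS yz; apply => k; have := h k.+1 => /=; lia.
- have := h 1%N; rewrite /= !take0 /= addn0 add0n; case: e h => // e h _.
  have := IH z e _ m.+1 bS nS yz; rewrite (_ : (fun v => f (v + e).+1) =
    fun v => f (v + e.+1)%N); last by apply/funext => v; rewrite addnS.
  rewrite addSnnS; apply => k; have := h k.+1 => /=; lia.
- have := IH z e.+1 _ m bf ndf yz; rewrite (_ : (fun v => f (v.+1 + e)%N) =
    fun v => f (v + e.+1)%N); last by apply/funext => v; rewrite addSnnS.
  rewrite addnS; apply => k; have := h k.+1 => /=; lia.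
- apply: IH => // k; have := h k.+1 => /=; lia.
Qed.

(** The m-th left step is among the first k coins, hence so are the right steps
    before it. *)
Lemma offspring_coins_ub y k f m : bounded_seq f -> nondecr f ->
  (m <= count negb (take k y))%N ->
  offspring (coins y) f m <= f (count id (take k y)).
Proof.
elim: y k f m => [|b y IH] [|k] f m bf ndf;
  try by case: m => //= _; rewrite lexx.
case: m => [|m]; first by rewrite offspring0 => _; apply: nondecrW.
rewrite offspring_coin; case: b => /= h; last exact: IH.
by apply: (IH k (fun v => f v.+1)) => //; exact: bounded_S.
Qed.

(** The m-th left step comes after the first k coins, so that all the right
    steps among these coins count. *)
Lemma offspring_coins_lb z k f m : bounded_seq f -> nondecr f ->
  (count negb (take k z) < m)%N ->
  f (count id (take k z)) <= offspring (coins z) f m.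
Proof.
elim: z k f m => [|b z IH] [|k] f m bf ndf;
  try by move=> _; apply: offspring_ge => //;
    (exact: coins_in01 || (move=> v; exact: (@nondecrW _ f 0))).
case: m => [|m] //; rewrite offspring_coin; case: b => /= h; last exact: IH.
by apply: (IH k (fun v => f v.+1)) => //; exact: bounded_S.
Qed.

(** Wait for as many left steps as y has among its first k coins.  Then y stops
    by time k, while z, with fewer left steps there, goes on after time k. *)
Lemma offspring_coins_lt y z k f : bounded_seq f -> nondecr f ->
  size y = size z ->
  (count id (take k y) < count id (take k z))%N ->
  f (count id (take k y)).+1 - f (count id (take k y)) <=
  offspring (coins z) f (count negb (take k y)) -
  offspring (coins y) f (count negb (take k y)).
Proof.
move=> bf ndf yz lt_yz; have := count_predC id (take k y).
have := count_predC id (take k z); rewrite !size_take yz => cz cy.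
have nz : (count negb (take k z) < count negb (take k y))%N.
  have E s : count (predC id) s = count negb s by apply: eq_count.
  by move: cz cy; rewrite !E; lia.
have ub := offspring_coins_ub bf ndf (leqnn (count negb (take k y))).
have lb := offspring_coins_lb bf ndf nz.
have := nondecrW ndf lt_yz; lra.
Qed.

Definition coin_weight n (p : n.-tuple R) (y : n.-tuple bool) : R :=
  \prod_(j < n) (if tnth y j then tnth p j else 1 - tnth p j).

Lemma sum_bool_tuple n (F : n.+1.-tuple bool -> R) :
  \sum_y F y = \sum_(y : n.-tuple bool) F [tuple of true :: y] +
               \sum_(y : n.-tuple bool) F [tuple of false :: y].
Proof.
rewrite (reindex (fun by' : bool * n.-tuple bool =>
    [tuple of by'.1 :: by'.2] : n.+1.-tuple bool)).
  rewrite -(pair_bigA _ (fun b (y : n.-tuple bool) => F [tuple of b :: y])) /=.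
  by rewrite big_bool.
exists (fun y : n.+1.-tuple bool => (thead y, [tuple of behead y])).
  move=> [b y] _ /=.
  by congr pair; exact: val_inj.
by move=> y _; rewrite [RHS]tuple_eta.
Qed.

(** [offspring] is affine in each cookie, hence it is an average over the
    prescribed coins. *)
Lemma offspring_expect n (p : n.-tuple R) f m : bounded_seq f ->
  offspring p f m =
  \sum_(y : n.-tuple bool) coin_weight p y * offspring (coins y) f m.
Proof.
move=> bf; elim: n p f m bf => [|n IH] p f m bf.
  rewrite (tuple0 p) (big_pred1 [tuple of [::]]) => [|y]; last first.
    by rewrite (tuple0 y); apply/esym/eqP.
  by rewrite /coin_weight big_ord0 mul1r.
case/tupleP: p => a p.
have wE b (y : n.-tuple bool) :
    coin_weight [tuple of a :: p] [tuple of b :: y] =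
    (if b then a else 1 - a) * coin_weight p y.
  rewrite /coin_weight big_ord_recl !tnth0; congr (_ * _).
  by apply: eq_bigr => j _; rewrite !tnthS.
rewrite sum_bool_tuple; case: m => [|m].
  rewrite offspring0; under eq_bigr do rewrite wE offspring0 -mulrA.
  under [X in _ = _ + X]eq_bigr do rewrite wE offspring0 -mulrA.
  rewrite -!mulr_sumr -mulrDl addrC subrK mul1r.
  by have := IH p f 0%N bf; under eq_bigr do rewrite offspring0; rewrite offspring0.
rewrite [LHS]/=.
under eq_bigr do rewrite wE -mulrA offspring_coin.
under [X in _ = _ + X]eq_bigr do rewrite wE -mulrA offspring_coin.
by rewrite -!mulr_sumr -!IH//; exact: bounded_S.
Qed.

End coin_sequences.

(** * Survival when the total drift exceeds one *)

Section survival.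
Context {R : realType}.
Implicit Types (f : nat -> R) (l : seq R) (v n : nat).

(** The individuals of a generation are the right steps made at one site. *)
Fixpoint surv l n : nat -> R :=
  if n is n'.+1 then offspring l (surv l n') else fun v => (0 < v)%N%:R.

Lemma surv01 l n v : in01 l -> 0 <= surv l n v <= 1.
Proof.
move=> l01; elim: n v => [|n IH] v /=; last exact: offspring01.
by case: (0 < v)%N; rewrite ?lexx ler01.
Qed.

Lemma bounded_surv l n : in01 l -> bounded_seq (surv l n).
Proof. by move=> l01; apply: bounded_unit => v; exact: surv01. Qed.

Lemma nondecr_surv l n : in01 l -> nondecr (surv l n).
Proof.
move=> l01; elim: n => [|n IH] /=; last first.
  by apply: nondecr_offspring => //; exact: bounded_surv.
by case=> [|v] /=; rewrite ?lexx ?ler01.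
Qed.

Lemma surv_at0 l n : surv l n 0 = 0.
Proof. by elim: n => //= n IH; rewrite offspring0. Qed.

(** From a single individual, the first coin decides whether there is
    offspring. *)
Lemma surv_once l : surv l 1 1 = nth 2^-1 l 0.
Proof.
rewrite -[in LHS](drop0 l) /= offspring_drop; last first.
  by apply: bounded_unit => -[|v]; rewrite /= ?lexx ?ler01.
by rewrite offspring_cst offspring0 mulr1 mulr0 addr0.
Qed.

(** First-order expansion at u = 0: the linear coefficient is the total drift.
    *)
Lemma prod_le_quadratic l : in01 l -> exists2 C : R, 0 <= C &
  forall u, 0 <= u <= 1 -> 0 <= \prod_(a <- l) (1 - (2 * a - 1) * u) <=
    1 - (\sum_(a <- l) (2 * a - 1)) * u + C * u ^+ 2.
Proof.
elim: l => [_|a l IH /= /andP[/andP[a0 a1] /IH [C C0 hC]]].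
  by exists 0 => // u _; rewrite !big_nil mul0r mul0r subr0 addr0 lexx ler01.
set s := \sum_(a <- l) _ in hC; set d := 2 * a - 1.
have d1 : `|d| <= 1 by rewrite ler_norml; apply/andP; split; rewrite /d; lra.
exists (2 * C + `|s|) => [|u u01]; first by rewrite addr_ge0// mulr_ge0.
have /andP[] := hC u u01; rewrite !big_cons -/d -/s.
case/andP: u01 => u0 u1; move: (\prod_(a <- l) _) => P P0 hP.
have du : 0 <= 1 - d * u <= 2.
  by move: d1; rewrite ler_norml => /andP[? ?]; apply/andP; split; nra.
have [/andP[du0 du2] uu] := (du, sqr_ge0 u).
rewrite mulr_ge0//= (le_trans (ler_wpM2l du0 hP))//.
have -> : (1 - d * u) * (1 - s * u + C * u ^+ 2) =
  1 - (d + s) * u + (d * s + C * (1 - d * u)) * u ^+ 2 by ring.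
rewrite lerD2l ler_wpM2r//.
have : d * s <= `|s|.
  by rewrite (le_trans (ler_norm _))// normrM ler_piMl.
have := ler_wpM2l C0 du2; lra.
Qed.

Section lyapunov.
Variables (l : seq R) (t0 : nat) (c : R).
Hypotheses (l01 : in01 l) (t0_gt1 : (1 < t0)%N) (c_gt1 : 1 < c).
Let t i : R := (t0 + i)%:R.
Hypothesis drift : forall i,
  0 <= \prod_(a <- l) (1 - (2 * a - 1) / t i) <= 1 - c / t i.

(** By [offspring_exp] the transition operator moves the term of parameter t to
    the term of parameter t + 1 and multiplies it by the product over the
    cookies.  The weights absorb this product, so that the operator maps a
    partial sum to the next one without its first term. *)
Definition lyap_weight := fix w i : R :=
  if i is i'.+1 then w i' * \prod_(a <- l) (1 - (2 * a - 1) / t i') else 1.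

Definition lyap n v : R := \sum_(i < n) lyap_weight i * (1 - (t i)^-1) ^+ v.

Lemma lyap_index_ge2 i : 2 <= t i.
Proof. by rewrite (ler_nat _ 2) (leq_trans t0_gt1)// leq_addr. Qed.

Lemma lyap_base01 i : 0 < 1 - (t i)^-1 <= 1.
Proof.
have ti : 1 < t i by rewrite (lt_le_trans _ (lyap_index_ge2 i))// ltrDl.
have t_gt0 : 0 < t i by rewrite (lt_trans ltr01).
by rewrite subr_gt0 invf_lt1// ti gerBl invr_ge0 ltW.
Qed.

Lemma lyap_weight_ge0 i : 0 <= lyap_weight i.
Proof.
by elim: i => //= i IH; rewrite mulr_ge0//; case/andP: (drift i).
Qed.

(** The weights decay at least like t^-c with c > 1: the quantity (t - 1) w
    decreases by at least (c - 1) w at each index, so that the sum telescopes.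
    *)
Lemma lyap_weight_sum n : \sum_(i < n) lyap_weight i <= (t 0 - 1) / (c - 1).
Proof.
suff h : (c - 1) * \sum_(i < n) lyap_weight i <=
    (t 0 - 1) - (t n - 1) * lyap_weight n.
  rewrite ler_pdivlMr ?subr_gt0// mulrC (le_trans h)// gerBl.
  by rewrite mulr_ge0 ?lyap_weight_ge0//; have := lyap_index_ge2 n; lra.
elim: n => [|n IH]; first by rewrite big_ord0 mulr0 mulr1 subrr.
rewrite big_ord_recr /= mulrDr.
have tS : t n.+1 = t n + 1 by rewrite /t addnS natr1.
have t2 := lyap_index_ge2 n; have tn0 : t n != 0 by rewrite gt_eqF//; lra.
have /andP[_ hP] := drift n; have w0 := lyap_weight_ge0 n.
have : t n * (lyap_weight n * \prod_(a <- l) (1 - (2 * a - 1) / t n)) <=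
    (t n - c) * lyap_weight n.
  rewrite mulrCA [leRHS]mulrC ler_wpM2l//.
  have -> : t n - c = t n * (1 - c / t n).
    by rewrite mulrBr mulr1 mulrC divfK.
  by rewrite ler_wpM2l//; lra.
rewrite tS; lra.
Qed.

Lemma lyap_sum_bounded n v : 0 <= lyap n v <= \sum_(i < n) lyap_weight i.
Proof.
apply/andP; split.
  apply: sumr_ge0 => i _; rewrite mulr_ge0 ?lyap_weight_ge0// exprn_ge0//.
  by case/andP: (lyap_base01 i) => /ltW.
apply: ler_sum => i _; rewrite ler_piMr ?lyap_weight_ge0// exprn_ile1//;
  by case/andP: (lyap_base01 i) => /ltW.
Qed.

Lemma bounded_lyap n : bounded_seq (lyap n).
Proof.
exists (\sum_(i < n) lyap_weight i) => v.
by case/andP: (lyap_sum_bounded n v) => ? ?; rewrite ger0_norm.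
Qed.

Lemma offspring_lyap n v : (size l <= v)%N ->
  offspring l (lyap n) v <= lyap n.+1 v.
Proof.
move=> lv; suff -> : offspring l (lyap n) v =
    \sum_(i < n) lyap_weight i.+1 * (1 - (t i.+1)^-1) ^+ v.
  rewrite /lyap big_ord_recl /= lerDr mul1r exprn_ge0//.
  by case/andP: (lyap_base01 0) => /ltW.
elim: n => [|n IH].
  rewrite big_ord0 -[RHS](offspring_cst l 0 v); congr (offspring _ _ _).
  by apply/funext => w; rewrite /lyap big_ord0.
have -> : lyap n.+1 =
    fun w => 1 * lyap n w + lyap_weight n * (1 - (t n)^-1) ^+ w.
  by apply/funext => w; rewrite /lyap big_ord_recr mul1r.
rewrite offspring_lin ?mul1r; last 2 first.
- exact: bounded_lyap.
- apply: bounded_unit => w; have /andP[h1 h2] := lyap_base01 n.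
  by rewrite exprn_ge0 ?exprn_ile1//= ltW.
rewrite IH big_ord_recr /= offspring_exp//; last by have := lyap_index_ge2 n; lra.
have -> : t n + 1 = t n.+1 by rewrite /t addnS natr1.
by rewrite -[in RHS]mulrA [X in _ = _ + _ * X]mulrC.
Qed.

(** The supermartingale property holds only from sizes that are at least the
    number of cookies; below, the first term alone is at least the normalizing
    factor, and the bound is trivial.  One more term is used in each
    generation. *)
Lemma extinct_le_lyap n v :
  (1 - (t 0)^-1) ^+ size l * (1 - surv l n v) <= lyap n.+1 v.
Proof.
have /andP[s0 s1] := lyap_base01 0.
set m0 := _ ^+ size l; have m0_ge0 : 0 <= m0 by rewrite exprn_ge0// ltW.
have lyap_ge k : (1 - (t 0)^-1) ^+ v <= lyap k.+1 v.
  rewrite /lyap big_ord_recl mul1r lerDl; apply: sumr_ge0 => i _.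
  rewrite mulr_ge0 ?lyap_weight_ge0// exprn_ge0//.
  by case/andP: (lyap_base01 (lift ord0 i)) => /ltW.
elim: n v lyap_ge => [|n IH] v lyap_ge.
  rewrite (le_trans _ (lyap_ge _))//; case: v {lyap_ge} => [|v] /=.
    by rewrite expr0 subr0 mulr1 exprn_ile1// ltW.
  by rewrite subrr mulr0 exprn_ge0// ltW.
have h01 := surv01 n.+1 v l01.
case: (ltnP v (size l)) => vl.
  rewrite (le_trans _ (lyap_ge _))// (@le_trans _ _ m0)//.
    by rewrite ler_piMr//; case/andP: h01; lra.
  by apply: ler_wiXn2l => //; [exact: ltW|exact: ltnW].
rewrite (le_trans _ (offspring_lyap _ vl))//.
have bc : bounded_seq (fun=> 1 : R) by exists 1 => ?; rewrite normr1.
have -> : m0 * (1 - surv l n.+1 v) =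
    offspring l (fun w => m0 * 1 + (- m0) * surv l n w) v.
  rewrite offspring_lin//; last exact: bounded_surv.
  by rewrite offspring_cst /=; ring.
apply: le_offspring => //.
- by apply: bounded_lin => //; exact: bounded_surv.
- exact: bounded_lyap.
move=> w; have := IH w; rewrite mulr1 mulNr mulrBr mulr1; apply.
move=> k; rewrite /lyap big_ord_recl mul1r lerDl; apply: sumr_ge0 => i _.
rewrite mulr_ge0 ?lyap_weight_ge0// exprn_ge0//.
by case/andP: (lyap_base01 (lift ord0 i)) => /ltW.
Qed.

(** The weights are summable, so that beyond some index they contribute little
    for every v, and the finitely many other terms tend to 0 when v grows. *)
Lemma lyap_small (e : R) : 0 < e -> exists v, forall n, lyap n v <= e.
Proof.
move=> e0; pose S := [set \sum_(i < n) lyap_weight i | n in [set: nat]].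
have hS : has_sup S.
  split; first by exists (\sum_(i < 0) lyap_weight i); exists 0%N.
  by exists ((t 0 - 1) / (c - 1)) => _ [n _ <-]; exact: lyap_weight_sum.
have e2 : 0 < e / 2 by lra.
have [_ [n0 _ <-] hn0] := sup_adherent e2 hS.
have /andP[s0 s1] := lyap_base01 n0.
have s1' : 1 - (t n0)^-1 < 1.
  by rewrite ltrBlDr ltrDl invr_gt0; have := lyap_index_ge2 n0; lra.
have [W W0 hW] : exists2 W : R, 0 < W & forall n, \sum_(i < n) lyap_weight i <= W.
  exists ((t 0 - 1) / (c - 1)); last exact: lyap_weight_sum.
  by rewrite divr_gt0// subr_gt0//; have := lyap_index_ge2 0; lra.
have [v hv] : exists v, (1 - (t n0)^-1) ^+ v <= e / 2 / W.
  have : (fun k => (1 - (t n0)^-1) ^+ k) @ \oo --> (0 : R).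
    by apply: cvg_expr; rewrite ger0_norm// ltW.
  move=> /cvgrPdist_le /(_ (e / 2 / W)); case; first by rewrite divr_gt0.
  move=> k _ /(_ k (leqnn k)); rewrite /= sub0r normrN ger0_norm.
    by move=> h; exists k.
  by rewrite exprn_ge0// ltW.
exists v => n.
have -> : e = e / 2 + e / 2 by lra.
have le_n : lyap n v <= lyap (n0 + n) v.
  rewrite /lyap addnC big_split_ord /= lerDl; apply: sumr_ge0 => i _.
  rewrite mulr_ge0 ?lyap_weight_ge0// exprn_ge0//.
  by case/andP: (lyap_base01 (n + i)) => /ltW.
(* The weights beyond n0 sum to at most e / 2, by the choice of n0. *)
rewrite (le_trans le_n)// {1}/lyap big_split_ord /= lerD//.
  apply: (@le_trans _ _ (\sum_(i < n0) lyap_weight i * (e / 2 / W))).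
    apply: ler_sum => i _; rewrite ler_wpM2l ?lyap_weight_ge0// (le_trans _ hv)//.
    have /andP[i0 i1] := lyap_base01 i.
    apply: lerXn2r; rewrite ?nnegrE; [exact: ltW..|].
    rewrite lerD2l lerN2 lef_pV2 ?posrE.
    - by rewrite ler_nat leq_add2l ltnW.
    - by have := lyap_index_ge2 n0; lra.
    - by have := lyap_index_ge2 i; lra.
  rewrite -mulr_suml mulrCA ler_piMr//; first exact: ltW.
  by rewrite ler_pdivrMr// mul1r.
apply: (@le_trans _ _ (\sum_(i < n) lyap_weight (n0 + i))).
  apply: ler_sum => i _; rewrite ler_piMr ?lyap_weight_ge0// exprn_ile1//;
    by case/andP: (lyap_base01 (n0 + i)) => /ltW.
have : \sum_(i < n0 + n) lyap_weight i <= sup S.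
  by apply: ub_le_sup; [case: hS|exists (n0 + n)%N].
rewrite big_split_ord /=; lra.
Qed.

End lyapunov.

(** From a large initial size the Lyapunov bound on extinction is at most 1/2
    in every generation. *)
Lemma surv_bounded_below l : in01 l -> 1 < \sum_(a <- l) (2 * a - 1) ->
  exists v, forall n, 2^-1 <= surv l n v.
Proof.
move=> l01 d1; have [C C0 hC] := prod_le_quadratic l01.
set d := \sum_(a <- l) _ in d1 hC.
(* Any c strictly between 1 and d leaves room for the quadratic error. *)
pose c := (1 + d) / 2; have c1 : 1 < c by rewrite /c; lra.
pose t0 := (Num.truncn (C / (d - c))).+2.
have dc : 0 < d - c by rewrite /c; lra.
have drift i : 0 <= \prod_(a <- l) (1 - (2 * a - 1) / (t0 + i)%:R) <=
    1 - c / (t0 + i)%:R.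
  have t2 : 2 <= (t0 + i)%:R :> R by rewrite (ler_nat _ 2); lia.
  have Ct : C / (d - c) <= (t0 + i)%:R.
    have /ltW h := truncnS_gt (C / (d - c)).
    by rewrite (le_trans h)// ler_nat (leq_trans (leqnSn _) (leq_addr _ _)).
  move: (t0 + i)%:R t2 Ct => t t2 Ct.
  have u0 : 0 < t^-1 by rewrite invr_gt0; lra.
  have u1 : t^-1 <= 1 by rewrite invf_le1; lra.
  have /andP[-> /= h] := hC t^-1 (introT andP (conj (ltW u0) u1)).
  rewrite (le_trans h)//.
  have : C * t^-1 <= d - c.
    by rewrite ler_pdivrMr ?(lt_le_trans _ t2)// mulrC -ler_pdivrMr.
  by move/(ler_wpM2r (ltW u0)); rewrite expr2; lra.
have m0 : 0 < (1 - (t0 + 0)%:R^-1) ^+ size l :> R.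
  by rewrite exprn_gt0//; case/andP: (@lyap_base01 t0 isT 0%N).
have t0_gt1 : (1 < t0)%N by [].
have [v hv] := lyap_small t0_gt1 c1 drift (divr_gt0 m0 (@ltr0Sn R 1)).
exists v => n; have := extinct_le_lyap l01 t0_gt1 drift n v.
move=> /le_trans /(_ (hv n.+1)); rewrite ler_pM2l//; lra.
Qed.

End survival.

(** * The gap between two survival probabilities *)

Section survival_gap.
Context {R : realType}.
Variables (p q : seq R) (e kappa : R) (m i : nat).
Hypotheses (e_gt0 : 0 < e) (e_half : e <= 2^-1).
Hypotheses (ep : elliptic e p) (eq : elliptic e q).
Hypothesis drift_p : 1 < \sum_(a <- p) (2 * a - 1).
Hypothesis dom : forall (f : nat -> R) n, bounded_seq f -> nondecr f ->
  offspring p f n <= offspring q f n.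
Hypothesis kappa_gt0 : 0 < kappa.
Hypothesis gap : forall f : nat -> R, bounded_seq f -> nondecr f ->
  kappa * (f i.+1 - f i) <= offspring q f m - offspring p f m.

Let p01 : in01 p. Proof. exact: elliptic_in01 (ltW e_gt0) ep. Qed.
Let q01 : in01 q. Proof. exact: elliptic_in01 (ltW e_gt0) eq. Qed.
Let e_strip : 0 <= e <= 2^-1. Proof. by rewrite ltW. Qed.

Lemma le_surv n v : surv p n v <= surv q n v.
Proof.
elim: n v => //= n IH v; apply: (@le_trans _ _ (offspring p (surv q n) v)).
  by apply: le_offspring => //; exact: bounded_surv.
by apply: dom; [exact: bounded_surv|exact: nondecr_surv].
Qed.

(** The survival probability for p is bounded below from one individual, hence
    so is its increment from i to i + 1.  This makes q better than p by a fixed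
    amount from m individuals, a size reached from one individual in one
    generation with a fixed probability. *)
Lemma surv_gap : exists2 k : R, 0 < k &
  forall n, surv p n.+4 1 + k <= surv q n.+4 1.
Proof.
have [v hv] := surv_bounded_below p01 drift_p.
pose k1 := e ^+ v.+1 * 2^-1.
have hk1 n : k1 <= surv p n.+1 1.
  apply: (@le_trans _ _ (e ^+ v.+1 * surv p n v)).
    by rewrite ler_wpM2l ?exprn_ge0// ltW.
  apply: offspring1_ge => //; first exact: bounded_surv.
  by move=> w; case/andP: (surv01 n w p01).
have hk2 n : e ^+ i.+1 * k1 <= surv p n.+2 i.+1 - surv p n.+2 i.
  apply: (@le_trans _ _ (e ^+ i.+1 * (surv p n.+1 1 - surv p n.+1 0))).
    by rewrite ler_wpM2l ?exprn_ge0 ?(ltW e_gt0)// surv_at0 subr0.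
  by apply: offspring_incr => //; [exact: bounded_surv|exact: nondecr_surv].
have hk3 n : kappa * (e ^+ i.+1 * k1) <= surv q n.+3 m - surv p n.+3 m.
  apply: (@le_trans _ _ (kappa * (surv p n.+2 i.+1 - surv p n.+2 i))).
    by rewrite ler_wpM2l// ltW.
  apply: (@le_trans _ _ (offspring q (surv p n.+2) m - offspring p (surv p n.+2) m)).
    by apply: gap; [exact: bounded_surv|exact: nondecr_surv].
  rewrite lerD2r; apply: (@le_offspring _ q (surv p n.+2) (surv q n.+2)) => //;
    [exact: bounded_surv..|].
  by move=> w; exact: le_surv.
exists (e ^+ m.+1 * (kappa * (e ^+ i.+1 * k1))).
  by rewrite /k1 !mulr_gt0 ?exprn_gt0// invr_gt0.
move=> n; pose f w := 1 * surv q n.+3 w + (-1) * surv p n.+3 w.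
have f_ge0 w : 0 <= f w by rewrite /f mul1r mulN1r subr_ge0 le_surv.
have bf : bounded_seq f by apply: bounded_lin; exact: bounded_surv.
have := @dom _ 1%N (bounded_surv n.+3 q01) (nondecr_surv n.+3 q01).
have := @offspring1_ge _ p f m e e_strip ep bf f_ge0.
rewrite /f offspring_lin; [|exact: bounded_surv..].
rewrite !mul1r !mulN1r => h1 h2.
have : e ^+ m.+1 * (kappa * (e ^+ i.+1 * k1)) <=
    e ^+ m.+1 * (surv q n.+3 m - surv p n.+3 m).
  by rewrite ler_wpM2l ?exprn_ge0 ?(ltW e_gt0).
move: h1 h2; rewrite -[surv p n.+4 1]/(offspring p (surv p n.+3) 1).
rewrite -[surv q n.+4 1]/(offspring q (surv q n.+3) 1).
move: (offspring _ _ _) (offspring _ _ _) (offspring _ _ _) => x y z.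
move: (e ^+ m.+1 * _) (e ^+ m.+1 * _) => u w; lra.
Qed.

End survival_gap.

(** * The walk and the branching process *)

Section walk_branching.
Context {R : realType}.
Variable p : seq R.
Implicit Types (c : nat -> nat) (x k n r v : nat).

Definition record_visit c x : nat -> nat :=
  fun j => if j == x then (c j).+1 else c j.

(** The probability that the walk is positive now and during the next n steps,
    when it is at x and each site j has been left c j times already. *)
Fixpoint stay_pos n x c : R :=
  if x is x'.+1 then
    if n is n'.+1 then
      nth 2^-1 p (c x) * stay_pos n' x.+1 (record_visit c x) +
      (1 - nth 2^-1 p (c x)) * stay_pos n' x' (record_visit c x)
    else 1
  else 0.

(** The walk is at x and each site j has been left c j times.  If the walk ends
    at 0, then from now on each site k <= x makes one left step more than site
    k - 1 makes right steps, and each site k > x makes as many; this is the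
    term (k <= x).  Given that site k - 1 makes v right steps, [escape x c r k
    v] is the probability that this process, run over the r sites from k on,
    asks site k + r for at least one left step.  For k = 1 and v = 0 it is the
    probability that the walk reaches r + 1 before 0. *)
Fixpoint escape x c r k v : R :=
  if r is r'.+1 then
    offspring (drop (c k) p) (escape x c r' k.+1) (v + (k <= x))%N
  else (0 < v + (k <= x))%N%:R.

Lemma escape_ext x c x' c' r k v : (x < k)%N -> (x' < k)%N ->
  (forall j, (k <= j)%N -> c j = c' j) ->
  escape x c r k v = escape x' c' r k v.
Proof.
elim: r k v => [|r IH] k v xk xk' cc' /=.
  by rewrite !(ltn_geF xk) !(ltn_geF xk').
rewrite !(ltn_geF xk) !(ltn_geF xk') cc'//.
suff -> : escape x c r k.+1 = escape x' c' r k.+1 by [].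
by apply/funext => w; apply: IH; [exact: leqW..|move=> j /ltnW; exact: cc'].
Qed.

Lemma escape_surv x c r k v : (x < k)%N -> (forall j, (k <= j)%N -> c j = 0%N) ->
  escape x c r k v = surv p r v.
Proof.
elim: r k v => [|r IH] k v xk c0 /=; first by rewrite (ltn_geF xk) addn0.
rewrite (ltn_geF xk) addn0 c0// drop0; congr (offspring _ _ _); apply/funext => w.
by apply: IH; [exact: leqW|move=> j /ltnW; exact: c0].
Qed.

Lemma escape_start c r : (forall j, (0 < j)%N -> c j = 0%N) ->
  escape 1 c r 1 0 = surv p r 1.
Proof.
case: r => [|r] c0 //=; rewrite c0// drop0; congr (offspring _ _ _).
by apply/funext => v; apply: escape_surv => // j /ltnW; exact: c0.
Qed.

Lemma escape_at0 c r k : (0 < k)%N -> escape 0 c r k 0 = 0.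
Proof.
case: k => // k _; case: r => //= r; rewrite offspring0.
by elim: r k => //= r IH k; rewrite offspring0.
Qed.

Lemma escape_far x c r k v : (k + r <= x)%N -> escape x c r k v = 1.
Proof.
elim: r k v => [|r IH] k v kx /=.
  by rewrite (leq_trans (leq_addr 0 k)) ?addn1.
rewrite -[RHS](offspring_cst (drop (c k) p) 1 (v + (k <= x))%N).
by congr (offspring _ _ _); apply/funext => w; apply: IH; rewrite addSnnS.
Qed.

Hypothesis p01 : in01 p.

Lemma drop_in01 k : in01 (drop k p).
Proof. by apply/allP => a /mem_drop /(allP p01). Qed.

Lemma escape01 x c r k v : 0 <= escape x c r k v <= 1.
Proof.
elim: r k v => [|r IH] k v /=; last by apply: offspring01 => //; exact: drop_in01.
by case: (0 < _)%N; rewrite ?lexx ler01.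
Qed.

Lemma bounded_escape x c r k : bounded_seq (escape x c r k).
Proof. by apply: bounded_unit => v; exact: escape01. Qed.

(** Read the next coin of site x.  After a right step, site x waits for as many
    left steps as before, and its additional right step is the term added at x
    + 1, which is now visited.  After a left step, site x waits for one left
    step less: the term added at x disappears. *)
Lemma escape_harmonic x c r k v : (0 < k)%N -> (k <= x < k + r)%N ->
  escape x c r k v =
  nth 2^-1 p (c x) * escape x.+1 (record_visit c x) r k v +
  (1 - nth 2^-1 p (c x)) * escape x.-1 (record_visit c x) r k v.
Proof.
elim: r k v => [|r IH] k v k0 /andP[kx xk]; first by lia.
case: (ltngtP k x) kx => // [kx _|kx _]; last first.
  subst k => /=; rewrite leqnn leqnSn /= addn1 offspring_drop; last first.
    exact: bounded_escape.
  rewrite {1 3}/record_visit eqxx; congr (_ * _ + _ * _).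
    congr (offspring _ _ _); apply/funext => w.
    case: r {IH xk} => [|r] /=; first by rewrite ltnSn addn1.
    rewrite ltnn ltnSn addn0 addn1 {1}/record_visit gtn_eqF//.
    suff -> : escape x c r x.+2 = escape x.+1 (record_visit c x) r x.+2 by [].
    apply/funext => u; apply: escape_ext => // j xj.
    by rewrite /record_visit gtn_eqF// ltnW.
  rewrite {1}(_ : (x <= x.-1)%N = false) ?addn0; last by lia.
  congr (offspring _ _ _); apply/funext => w; apply: escape_ext => //; first lia.
  by move=> j xj; rewrite /record_visit gtn_eqF.
rewrite /= !(ltnW kx) (leqW (ltnW kx)) (_ : (k <= x.-1)%N); last by lia.
rewrite {1 3}/record_visit ltn_eqF// -offspring_lin; last 2 first.
- exact: bounded_escape.
- exact: bounded_escape.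
congr (offspring _ _ _); apply/funext => w; apply: IH => //; lia.
Qed.

Lemma stay_pos01 n x c : 0 <= stay_pos n x c <= 1.
Proof.
elim: n x c => [|n IH] [|x] c /=; rewrite ?lexx ?ler01//.
have : 0 <= nth 2^-1 p (c x.+1) <= 1.
  case: (ltnP (c x.+1) (size p)) => h; first exact: (all_nthP _ p01).
  rewrite nth_default//; apply/andP; split; lra.
move: (nth _ _ _) => a /andP[a0 a1].
have /andP[s0 s1] := IH x.+2 (record_visit c x.+1).
have /andP[u0 u1] := IH x (record_visit c x.+1).
by apply/andP; split; nra.
Qed.

(** In n steps the walk cannot pass the right end of the window, so that it has
    to stay positive in order to escape later. *)
Lemma escape_le_stay n x c r : (x + n <= r.+1)%N ->
  escape x c r 1 0 <= stay_pos n x c.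
Proof.
elim: n x c => [|n IH] [|x] c h; rewrite ?escape_at0//.
  by case/andP: (escape01 x.+1 c r 1 0).
rewrite escape_harmonic//; last by lia.
have : 0 <= nth 2^-1 p (c x.+1) <= 1.
  case: (ltnP (c x.+1) (size p)) => hc; first exact: (all_nthP _ p01).
  rewrite nth_default//; apply/andP; split; lra.
case/andP => a0 a1; rewrite /= lerD// ler_wpM2l ?subr_ge0// IH//; lia.
Qed.

Variable e : R.
Hypotheses (e_gt0 : 0 < e) (e_half : e <= 2^-1) (ep : elliptic e p).

(** The last term bounds the probability of being still inside the window.
    With L = 2/e, each step inside the window contracts the function L^(r+1) -
    L^x by the factor 1 - L^-(r+1), because right steps have probability at
    least e. *)
Lemma stay_le_escape n x c r : (x <= r.+1)%N ->
  stay_pos n x c <= escape x c r 1 0 +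
    (1 - (2 / e) ^- r.+1) ^+ n * ((2 / e) ^+ r.+1 - (2 / e) ^+ x).
Proof.
have e1 : e <= 1 by rewrite (le_trans e_half)// invf_le1// ler1n.
have l2 : 2 <= 2 / e by rewrite ler_pdivlMr// ler_piMr.
have el : e * (2 / e) = 2 by rewrite mulrCA divff ?mulr1// gt_eqF.
move: (2 / e) l2 el => L l2 el; set B := L ^+ r.+1.
have L0 : 0 < L by lra.
have B1 : 1 <= B by rewrite exprn_ege1//; lra.
have iB1 : B^-1 <= 1 by rewrite invf_le1//; lra.
have LB x' : (x' <= r.+1)%N -> L ^+ x' <= B.
  by move=> h; apply: ler_weXn2l => //; lra.
have g0 x' k : (x' <= r.+1)%N -> 0 <= (1 - B^-1) ^+ k * (B - L ^+ x').
  by move=> h; rewrite mulr_ge0 ?exprn_ge0 ?subr_ge0// LB.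
have far y c' k : stay_pos k y c' <= escape y c' r 1 0 +
    (1 - B^-1) ^+ k * (B - L ^+ y) \/ (0 < y < r.+1)%N \/ (r.+1 < y)%N.
  case: y => [|y].
    left; case: k => [|k] /=; rewrite addr_ge0 ?g0//; by case/andP: (escape01 0 c' r 1 0).
  case: (ltngtP y.+1 r.+1) => h; [by right; left|by right; right|].
  left; rewrite escape_far ?h// (le_trans (y := 1))//.
    by case/andP: (stay_pos01 k r.+1 c').
  by rewrite lerDl g0.
elim: n x c => [|n IH] x c xr.
  have [//|[/andP[x0 xr']|]] := far x c 0%N; last by lia.
  rewrite (le_trans (y := 1))//; first by case/andP: (stay_pos01 0 x c).
  rewrite expr0 mul1r (le_trans (y := B - L ^+ x))//; last first.
    by rewrite lerDr; case/andP: (escape01 x c r 1 0).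
  have : L ^+ x.+1 <= B by exact: LB.
  have : 1 <= L ^+ x by rewrite exprn_ege1//; lra.
  by rewrite exprS; nra.
have [//|[/andP[x0 xr']|]] := far x c n.+1; last by lia.
case: x x0 xr xr' => // x _ xr xr' {far}.
rewrite escape_harmonic//.
have /andP[] := elliptic_nth (c x.+1) e_half ep.
have := IH x (record_visit c x.+1) (ltnW xr).
have := IH x.+2 (record_visit c x.+1) xr'.
rewrite [stay_pos n.+1 _ _]/=; move: (nth _ _ _) => a.
move: (stay_pos _ _ _) (stay_pos _ _ _) => s1 s2.
rewrite [x.+1.-1]/=; move: (escape x.+2 _ _ _ _) (escape x _ _ _ _) => E1 E2.
move=> h1 h2 ea ae.
have a0 : 0 <= a by rewrite (le_trans (ltW e_gt0)).
have a1 : 0 <= 1 - a by rewrite subr_ge0 (le_trans ae)// gerBl ltW.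
apply: (le_trans (lerD (ler_wpM2l a0 h1) (ler_wpM2l a1 h2))).
rewrite [_ ^+ n.+1]exprSr -mulrA; set X := (1 - B^-1) ^+ n.
rewrite [leLHS](_ : _ = (a * E1 + (1 - a) * E2) +
  X * (a * (B - L ^+ x.+2) + (1 - a) * (B - L ^+ x))); last by ring.
rewrite lerD2l ler_wpM2l ?exprn_ge0 ?subr_ge0//.
have Lx : L ^+ x.+2 = L * L ^+ x.+1 by rewrite exprS.
have P0 : 0 <= L ^+ x by rewrite exprn_ge0 ?ltW.
have P1 : 1 <= L ^+ x.+1 by rewrite exprn_ege1//; lra.
have : 0 <= B^-1 * L ^+ x.+1 by rewrite mulr_ge0 ?invr_ge0//; lra.
have : 2 * L ^+ x.+1 <= a * (L * L ^+ x.+1).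
  by rewrite -el mulrA -!mulrA ler_wpM2r// mulr_ge0//; lra.
have : B^-1 * B = 1 by rewrite mulVf// gt_eqF//; lra.
have : 0 <= (1 - a) * L ^+ x by rewrite mulr_ge0.
rewrite Lx; move: P1; move: (L ^+ x) (L ^+ x.+1) (B^-1) => y z w.
nra.
Qed.

End walk_branching.

(** * The law of the excited random walk *)

Section walk_law.
Context {R : realType} {M : nat} (p : M.-tuple R).
Context {d : measure_display} {T : measurableType d} (P : probability T R).
Variable X : nat -> {RV P >-> int}.
Implicit Types (x : nat -> int) (m n k : nat).

Definition cylinder m x : set T := [set w | forall k, (k <= m)%N -> X k w = x k].

Definition extend x m (v : int) : nat -> int :=
  fun k => if (k <= m)%N then x k else v.

(** The number of departures from j before time m, hence the number of coins of
    j that are used at time m. *)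
Definition past_visits x m (j : nat) : nat :=
  count (fun k => x k == j%:Z) (iota 0 m).

Definition positive_on m n : set T :=
  [set w | forall k, (m <= k <= n)%N -> 0 < X k w].

Lemma cylinder0 x : cylinder 0 x = [set w | X 0 w = x 0].
Proof.
apply/seteqP; split=> w /=; first by apply.
by move=> h k; rewrite leqn0 => /eqP->.
Qed.

Lemma cylinderS m x :
  cylinder m.+1 x = cylinder m x `&` [set w | X m.+1 w = x m.+1].
Proof.
apply/seteqP; split=> w /=.
  by move=> h; split=> [k km|]; apply: h => //; exact: leqW.
by move=> [h1 h2] k; rewrite leq_eqVlt => /predU1P[->//|]; rewrite ltnS; exact: h1.
Qed.

Lemma cylinder_extend m x v :
  cylinder m.+1 (extend x m v) = cylinder m x `&` [set w | X m.+1 w = v].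
Proof.
rewrite cylinderS /extend ltnn; congr (_ `&` _).
by apply/seteqP; split=> w /= h k km; have := h k km; rewrite km.
Qed.

Lemma filtration_cylinder m x : natural_filtration X m (cylinder m x).
Proof.
pose G := \big[setU/set0]_(i < m.+1) preimage_set_system setT (X i) measurable.
have gen k (v : int) : (k <= m)%N ->
    G.-sigma.-measurable [set w | X k w = v].
  rewrite -ltnS => km; apply: sub_sigma_algebra.
  rewrite /G (bigD1 (Ordinal km))//=; left; exists [set v] => //.
  by rewrite setTI.
suff: forall k, (k <= m)%N -> G.-sigma.-measurable (cylinder k x) by apply.
elim=> [|k IH] km; first by rewrite cylinder0; exact: gen.
by rewrite cylinderS; apply: measurableI; [apply: IH; exact: ltnW|exact: gen].
Qed.

Lemma measurable_at k (B : set int) : measurable [set w | B (X k w)].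
Proof. exact: (measurable_funPTI (X k) (Y := B)). Qed.

Lemma measurable_cylinder m x : measurable (cylinder m x).
Proof.
elim: m => [|m IH]; first by rewrite cylinder0; exact: (measurable_at 0 [set x 0%N]).
by rewrite cylinderS; apply: measurableI => //; exact: (measurable_at _ [set x _]).
Qed.

Lemma measurable_positive_on m n : measurable (positive_on m n).
Proof.
rewrite (_ : positive_on m n =
    \bigcap_(k in [set k | (m <= k <= n)%N]) [set w | 0 < X k w]).
  by apply: bigcap_measurableType => k _; exact: (measurable_at k [set v | 0 < v]).
by [].
Qed.

Lemma measurable_never_return :
  measurable [set w | forall n : nat, (0 < n)%N -> 0 < X n w].
Proof.
rewrite (_ : [set w | _] =
    \bigcap_(k in [set k | (0 < k)%N]) [set w | 0 < X k w]); last by [].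
by apply: bigcap_measurableType => k _; exact: (measurable_at k [set v | 0 < v]).
Qed.

Lemma visits_cylinder m x (j : nat) w : x m = j%:Z -> cylinder m x w ->
  visits X m w = (past_visits x m j).+1.
Proof.
move=> xm h; rewrite /visits /past_visits.
rewrite (eq_card (B := [pred k : 'I_m.+1 | x k == j%:Z])); last first.
  by move=> k; rewrite !inE !h// ?xm// -ltnS.
rewrite -sum1_card -(big_mkord (fun k => x k == j%:Z) (fun=> 1%N)) sum1_count.
by rewrite /index_iota subn0 -addn1 iotaD count_cat /= add0n xm eqxx addn0 addn1.
Qed.

Lemma past_visits_extend m x v (j : nat) : x m = j%:Z ->
  past_visits (extend x m v) m.+1 = record_visit (past_visits x m) j.
Proof.
move=> xm; apply/funext => i; rewrite /past_visits /record_visit -addn1 iotaD.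
rewrite count_cat /= add0n addn0 /extend leqnn xm.
rewrite (@eq_in_count _ _ (fun k => x k == i%:Z)); last first.
  by move=> k; rewrite mem_iota add0n /= => /ltnW ->.
rewrite eqz_nat eq_sym; case: eqP => _; by rewrite ?addn1 ?addn0.
Qed.

Hypothesis hX : is_ERW p X.

Let step m x (j : nat) := nth 2^-1 p (past_visits x m j).

Lemma cylinder_up m x (j : nat) : x m = j%:Z ->
  P (cylinder m.+1 (extend x m (x m + 1))) = ((step m x j)%:E * P (cylinder m x))%E.
Proof.
move=> xm; have [[_ /(_ _ (@filtration_cylinder m x)) h] _] := hX.2 m.
rewrite cylinder_extend.
rewrite (_ : _ `&` _ = cylinder m x `&` [set w | X m.+1 w = X m w + 1]).
  rewrite h -(integral_cst P (measurable_cylinder m x)).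
  apply: eq_integral => w; rewrite inE => hw.
  by rewrite /cookie (visits_cylinder xm hw).
by apply/seteqP; split=> w /= [hw]; rewrite (hw m)//.
Qed.

Lemma cylinder_down m x (j : nat) : x m = j%:Z ->
  P (cylinder m.+1 (extend x m (x m - 1))) =
  ((1 - step m x j)%:E * P (cylinder m x))%E.
Proof.
move=> xm; have [_ [_ /(_ _ (@filtration_cylinder m x)) h]] := hX.2 m.
rewrite cylinder_extend.
rewrite (_ : _ `&` _ = cylinder m x `&` [set w | X m.+1 w = X m w - 1]).
  rewrite h -(integral_cst P (measurable_cylinder m x)).
  apply: eq_integral => w; rewrite inE => hw.
  by rewrite /cookie (visits_cylinder xm hw).
by apply/seteqP; split=> w /= [hw]; rewrite (hw m)//.
Qed.

(** The conditional probabilities of the steps 1 and -1 add up to 1, so that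
    any other step has probability 0. *)
Lemma cylinder_split m x (j : nat) (B : set T) : x m = j%:Z -> measurable B ->
  P (cylinder m x `&` B) =
  (P (cylinder m.+1 (extend x m (x m + 1)) `&` B) +
   P (cylinder m.+1 (extend x m (x m - 1)) `&` B))%E.
Proof.
move=> xm mB.
set U := [set w | X m.+1 w = x m + 1]; set D := [set w | X m.+1 w = x m - 1].
have mU : measurable U by exact: (measurable_at _ [set x m + 1]).
have mD : measurable D by exact: (measurable_at _ [set x m - 1]).
have mC := measurable_cylinder m x.
have split3 (A : set T) : measurable A ->
    P A = (P (A `\` U `\` D) + P (A `&` D) + P (A `&` U))%E.
  move=> mA; rewrite (measureDI P mA mU); congr (_ + _)%E.
  rewrite (measureDI P (measurableD mA mU) mD); congr (_ + P _)%E.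
  apply/seteqP; split=> w /= [].
    by move=> [].
  move=> Aw Dw; split=> //; split=> //; rewrite /U /= Dw => /eqP.
  by rewrite (inj_eq (addrI _)).
have null : P (cylinder m x `\` U `\` D) = 0%E.
  have := split3 _ mC.
  rewrite -!cylinder_extend (cylinder_up xm) (cylinder_down xm).
  have finC := fin_num_measure P _ mC.
  have finN := fin_num_measure P _ (measurableD (measurableD mC mU) mD).
  rewrite -(fineK finC) -(fineK finN) -!EFinM -!EFinD => -[h].
  by congr EFin; lra.
have mCB : measurable (cylinder m x `&` B) by exact: measurableI.
rewrite !cylinder_extend -/U -/D (split3 _ mCB) [X in (X + _ + _)%E](_ : _ = 0%E).
  by rewrite add0e addeC; congr (P _ + P _)%E; rewrite setIAC.
apply/eqP; rewrite eq_le measure_ge0 andbT -null le_measure ?inE//.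
- by apply: measurableD => //; exact: measurableD.
- by apply: measurableD => //; exact: measurableD.
- by move=> w [[[? ?] ?] ?].
Qed.

(** The recursion of [stay_pos] on the number of steps is the tower property
    for the law of the walk conditioned on its first m steps. *)
Lemma positive_on_law n m x (j : nat) : x m = j%:Z ->
  P (cylinder m x `&` positive_on m (m + n)) =
  (P (cylinder m x) * (stay_pos p n j (past_visits x m))%:E)%E.
Proof.
have at0 k m' x' : x' m' = 0 -> (m' <= k)%N ->
    P (cylinder m' x' `&` positive_on m' k) = 0%E.
  move=> x0 mk; rewrite (_ : _ `&` _ = set0) ?measure0//.
  apply/seteqP; split=> w //= -[/(_ m' (leqnn _)) hw /(_ m')].
  by rewrite leqnn mk hw x0 ltxx => /(_ isT).
elim: n m x j => [|n IH] m x [|j] xm.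
- by rewrite at0 ?addn0// mule0.
- rewrite addn0 /= mule1; congr (P _); apply/seteqP; split=> w /=; first by case.
  move=> hw; split=> // k /andP[mk km]; rewrite hw// (_ : k = m) ?xm//.
  by apply/eqP; rewrite eqn_leq mk km.
- by rewrite at0 ?leq_addr// mule0.
rewrite (_ : _ `&` _ = cylinder m x `&` positive_on m.+1 (m.+1 + n)); last first.
  rewrite addnS -addSn; apply/seteqP; split=> w /= [hw hp]; split=> // k.
    by move=> /andP[mk kn]; apply: hp; rewrite kn ltnW.
  move=> /andP[]; rewrite leq_eqVlt => /predU1P[<- _|mk kn].
    by rewrite hw// xm.
  by apply: hp; rewrite mk.
rewrite (cylinder_split xm); last exact: measurable_positive_on.
have xup : extend x m (x m + 1) m.+1 = j.+2%:Z.
  by rewrite /extend ltnn xm -[j.+2]addn1 PoszD.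
have xdown : extend x m (x m - 1) m.+1 = j%:Z.
  by rewrite /extend ltnn xm -addn1 PoszD addrK.
rewrite (IH _ _ _ xup) (IH _ _ _ xdown) (cylinder_up xm) (cylinder_down xm).
rewrite !(past_visits_extend _ xm) /step /=.
rewrite -(fineK (fin_num_measure P _ (measurable_cylinder m x))).
by rewrite -!EFinM -!EFinD; congr EFin; ring.
Qed.

Lemma positive_law n : P (positive_on 1 n.+1) =
  (nth 2^-1 p 0 * stay_pos p n 1 (fun j => (j == 0)%N))%:E.
Proof.
pose x0 := fun k : nat => 0 : int.
have x00 : x0 0%N = 0%N%:Z by [].
have pc0 : P (cylinder 0 x0) = 1%E by rewrite cylinder0; exact: hX.1.
have mp := measurable_positive_on 1 n.+1.
have -> : P (positive_on 1 n.+1) = P (cylinder 0 x0 `&` positive_on 1 n.+1).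
  have mC := measurable_cylinder 0 x0.
  rewrite (measureDI P mp mC) setIC [X in (X + _)%E](_ : _ = 0%E) ?add0e//.
  apply/eqP; rewrite eq_le measure_ge0 andbT.
  rewrite (_ : 0%E = P (~` cylinder 0 x0)).
    rewrite le_measure ?inE//; first exact: measurableD.
    exact: measurableC.
  by rewrite probability_setC// pc0 subee.
rewrite (cylinder_split x00)//.
have xup : extend x0 0 (x0 0%N + 1) 1 = 1%N%:Z by [].
have -> : P (cylinder 1 (extend x0 0 (x0 0%N - 1)) `&` positive_on 1 n.+1) = 0%E.
  rewrite (_ : _ `&` _ = set0) ?measure0//.
  by apply/seteqP; split=> w //= -[/(_ 1%N isT) hw /(_ 1%N isT)]; rewrite hw.
rewrite adde0 -add1n (positive_on_law _ xup) (cylinder_up x00) pc0 mule1.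
by rewrite (past_visits_extend _ x00) -EFinM.
Qed.

Lemma never_return_ub n : (P [set w | forall n : nat, (0 < n)%N -> (0 < X n w)%R] <=
  (nth 2^-1 p 0 * stay_pos p n 1 (fun j => (j == 0)%N))%:E)%E.
Proof.
rewrite -positive_law le_measure ?inE//; [|exact: measurable_positive_on|].
  exact: measurable_never_return.
by move=> w hw k /andP[k0 _]; exact: hw.
Qed.

(** Continuity of the measure along decreasing sequences of events. *)
Lemma never_return_lb (b : R) :
  (forall n, b <= nth 2^-1 p 0 * stay_pos p n 1 (fun j => (j == 0)%N)) ->
  (b%:E <= P [set w | forall n : nat, (0 < n)%N -> (0 < X n w)%R])%E.
Proof.
move=> hb.
have E : [set w | forall n : nat, (0 < n)%N -> 0 < X n w] =
    \bigcap_n positive_on 1 n.+1.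
  apply/seteqP; split=> w /= hw.
    by move=> n _ k /andP[k0 _]; exact: hw.
  by move=> [//|n] _; apply: (hw n I); rewrite /= leqnn.
have mE n : measurable (positive_on 1 n.+1) by exact: measurable_positive_on.
rewrite E; have : (P \o (fun n => positive_on 1 n.+1)) @ \oo -->
    P (\bigcap_n positive_on 1 n.+1).
  apply: nonincreasing_cvg_mu => //.
  - by rewrite (le_lt_trans (probability_le1 P (mE 0%N)))// ltry.
  - exact: bigcap_measurableType.
  - move=> n n' nn'; apply/subsetPset => w hw k /andP[k0 kn]; apply: hw.
    by rewrite k0 (leq_trans kn).
move=> h; rewrite -(cvg_lim _ h)//; apply: lime_ge; first exact/cvg_ex/ex_intro/h.
by apply: nearW => n; rewrite /= positive_law lee_fin.
Qed.

End walk_law.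

(** * The joint law of the coupled coins *)

Section coupling.
Context {R : realType} {M : nat}.
Implicit Types (p q : M.-tuple R) (y z : M.-tuple bool) (k : nat).

Section outcome.
Context {d : measure_display} {T : measurableType d} (P : probability T R).
Implicit Type Y : 'I_M -> {RV P >-> bool}.

Definition outcome Y (w : T) : M.-tuple bool := [tuple Y j w | j < M].

Lemma outcome_bigcap Y y : [set w | outcome Y w = y] =
  \bigcap_(j in [set j | j \in [set: 'I_M]%SET]) Y j @^-1` [set tnth y j].
Proof.
apply/seteqP; split=> w /= hw.
  by move=> j _ /=; rewrite -hw tnth_mktuple.
by apply: eq_from_tnth => j; rewrite tnth_mktuple hw//= finset.in_setT.
Qed.

Lemma measurable_outcome Y y : measurable [set w | outcome Y w = y].
Proof.
rewrite outcome_bigcap; apply: fin_bigcap_measurable => // j _.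
exact: (measurable_funPTI (Y j) (Y := [set tnth y j])).
Qed.

Lemma outcome_prob p Y y : cookie_env p -> independent_bernoulli p Y ->
  P [set w | outcome Y w = y] = (coin_weight p y)%:E.
Proof.
move=> p01 [indY lawY]; rewrite outcome_bigcap indY// /coin_weight.
rewrite (big_morph EFin (@EFinM R) erefl); apply: eq_big => [j|j _].
  by rewrite finset.in_setT.
have /andP[/ltW p0 /ltW p1] := p01 j.
have -> : P (Y j @^-1` [set tnth y j]) = bernoulli_prob (tnth p j) [set tnth y j].
  by rewrite -lawY.
rewrite bernoulli_probE ?p0//.
have in1 (a b : bool) : (a \in [set b]%classic) = (a == b).
  by apply/idP/eqP; rewrite inE.
by case: (tnth y j); rewrite !diracE !in1 /= mule1 mule0 ?adde0 ?add0e.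
Qed.

Lemma sum_outcome Y (A : set T) : measurable A ->
  P A = (\sum_(y : M.-tuple bool) P (A `&` [set w | outcome Y w = y]))%E.
Proof.
move=> mA; rewrite -[in LHS](setIT A).
have -> : [set: T] =
    \bigcup_(y in [set` index_enum (M.-tuple bool)]) [set w | outcome Y w = y].
  apply/seteqP; split=> w // _; exists (outcome Y w) => //=.
  exact: mem_index_enum.
rewrite setI_bigcupr measure_fin_bigcup//.
- by rewrite -fsbig_seq// index_enum_uniq.
- by move=> y y' _ _ [w [[_ <-] [_ <-]]].
- by move=> y _; apply: measurableI => //; exact: measurable_outcome.
Qed.

Lemma count_take (s : seq bool) k :
  count id (take k s) = (\sum_(j < size s | (j < k)%N) nth false s j)%N.
Proof.
rewrite big_mkcond; elim: s k => [|b s IH] [|k]; rewrite ?big_ord0//=.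
  by rewrite big1.
by rewrite big_ord_recl IH.
Qed.

Lemma partial_sumE Y k w : partial_sum Y k w = count id (take k (outcome Y w)).
Proof.
rewrite count_take /partial_sum size_tuple; apply: eq_bigr => j _.
by rewrite -tnth_nth tnth_mktuple.
Qed.

End outcome.

(** Passing to the joint law of the two coin sequences turns the almost sure
    comparison of the partial sums into a comparison for every pair of
    sequences of positive weight. *)
Lemma env_lt_joint p q : cookie_env p -> cookie_env q -> env_lt p q ->
  exists mu : M.-tuple bool -> M.-tuple bool -> R,
  [/\ forall y z, 0 <= mu y z,
      forall y, \sum_z mu y z = coin_weight p y,
      forall z, \sum_y mu y z = coin_weight q z,
      forall y z, 0 < mu y z ->
        forall k, (count id (take k y) <= count id (take k z))%N &
      exists y z k, 0 < mu y z /\ (count id (take k y) < count id (take k z))%N].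
Proof.
move=> p01 q01 [d [T [P [Y [Z [[iY iZ dom] [m0 m0M lt_m0]]]]]]].
pose A y z := [set w | outcome Y w = y] `&` [set w | outcome Z w = z].
have mY := measurable_outcome Y; have mZ := measurable_outcome Z.
have mA y z : measurable (A y z) by exact: measurableI.
have PE (B : set T) : measurable B -> P B = (fine (P B))%:E.
  by move=> mB; rewrite fineK// fin_num_measure.
have mpart (Q : rel nat) k : measurable
    [set w | Q (partial_sum Y k w) (partial_sum Z k w)].
  rewrite (_ : [set w | _] = \bigcup_(yz in [set yz : M.-tuple bool * M.-tuple bool |
      Q (count id (take k yz.1)) (count id (take k yz.2))]) A yz.1 yz.2).
    by apply: fin_bigcup_measurable => //; exact: finite_finset.
  apply/seteqP; split=> w /=.
    by rewrite !partial_sumE => Qw; exists (outcome Y w, outcome Z w).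
  by move=> [[y z] /= Qyz [/= Ey Ez]]; rewrite !partial_sumE Ey Ez.
exists (fun y z => fine (P (A y z))); split.
- by move=> y z; rewrite fine_ge0.
- move=> y; apply: EFin_inj; rewrite -(outcome_prob _ p01 iY) (sum_outcome Z)//.
  by rewrite -sumEFin; apply: eq_bigr => z _; rewrite -PE.
- move=> z; apply: EFin_inj; rewrite -(outcome_prob _ q01 iZ) (sum_outcome Y)//.
  by rewrite -sumEFin; apply: eq_bigr => y _; rewrite -PE// setIC.
- move=> y z mu_gt0.
  suff h k : (1 <= k <= M)%N -> (count id (take k y) <= count id (take k z))%N.
    case=> [|k]; first by rewrite !take0.
    case: (leqP k.+1 M) => kM; first exact: h.
    rewrite !take_oversize ?size_tuple ?(ltnW kM)//.
    case: (posnP M) => [M0|M0].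
      by have := count_size id y; rewrite size_tuple [leqRHS]M0 leqn0 => /eqP->.
    by have := h M; rewrite !take_oversize ?size_tuple// leqnn M0; exact.
  move=> kM; have mQ := mpart leq k.
  suff [w [[<- <-]]] : A y z `&` [set w | (partial_sum Y k w <= partial_sum Z k w)%N] !=set0.
    by rewrite /= !partial_sumE.
  apply/set0P/eqP => h; have := measureDI P (mA y z) mQ; rewrite h measure0 adde0.
  have null : P (~` [set w | (partial_sum Y k w <= partial_sum Z k w)%N]) = 0%E.
    by rewrite probability_setC// dom// subee.
  have : (P (A y z `\` [set w | (partial_sum Y k w <= partial_sum Z k w)%N]) <= 0)%E.
    rewrite -null le_measure ?inE//; first exact: measurableD.
    exact: measurableC.
  move=> le0 e; have : (P (A y z) <= 0)%E by rewrite e.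
  by rewrite PE// lee_fin leNgt mu_gt0.
- have mQ := mpart ltn m0.
  set Q := [set w | _] in mQ lt_m0.
  have [w [Qw mu_gt0]] : exists w, Q w /\
      (0 < P (A (outcome Y w) (outcome Z w)))%E.
    apply: contrapT => none; move: lt_m0; rewrite (sum_outcome Y)//.
    rewrite big1 ?ltxx// => y _; rewrite (sum_outcome Z); last exact: measurableI.
    rewrite big1// => z _; rewrite -setIA -/(A y z).
    have [->|/set0P[w [Qw [Yw Zw]]]] := eqVneq (Q `&` A y z) set0.
      exact: measure0.
    apply/eqP; rewrite eq_le measure_ge0 andbT leNgt; apply/negP => gt0.
    apply: none; exists w; split=> //; rewrite Yw Zw (lt_le_trans gt0)//.
    by rewrite le_measure ?inE//; exact: measurableI || exact: subIsetr.
  exists (outcome Y w), (outcome Z w), m0; split.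
    by rewrite -lte_fin -PE.
  by move: Qw; rewrite /Q /= !partial_sumE.
Qed.

End coupling.

(** * Strict monotonicity *)

Section joint_domination.
Context {R : realType} {M : nat} (p q : M.-tuple R).
Variable mu : M.-tuple bool -> M.-tuple bool -> R.
Hypothesis mu_ge0 : forall y z, 0 <= mu y z.
Hypothesis mu_p : forall y, \sum_z mu y z = coin_weight p y.
Hypothesis mu_q : forall z, \sum_y mu y z = coin_weight q z.
Hypothesis mu_le : forall y z, 0 < mu y z ->
  forall k, (count id (take k y) <= count id (take k z))%N.
Implicit Types (f : nat -> R) (y z : M.-tuple bool).

(** Both operators are averages over prescribed coins, taken here under the
    joint law. *)
Lemma joint_offspring f n : bounded_seq f ->
  offspring q f n - offspring p f n = \sum_(yz : M.-tuple bool * M.-tuple bool)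
    mu yz.1 yz.2 * (offspring (coins yz.2) f n - offspring (coins yz.1) f n).
Proof.
move=> bf; rewrite !offspring_expect//.
rewrite -(pair_bigA _ (fun y z =>
  mu y z * (offspring (coins z) f n - offspring (coins y) f n))) /=.
under [RHS]eq_bigr do under eq_bigr do rewrite mulrBr.
under [RHS]eq_bigr do rewrite sumrB.
rewrite sumrB exchange_big /=; congr (_ - _); apply: eq_bigr => y _.
  by rewrite -mu_q mulr_suml.
by rewrite -mu_p mulr_suml.
Qed.

Lemma joint_term_ge0 f n y z : bounded_seq f -> nondecr f ->
  0 <= mu y z * (offspring (coins z) f n - offspring (coins y) f n).
Proof.
move=> bf ndf; have := mu_ge0 y z; rewrite le_eqVlt => /predU1P[<-|gt0].
  by rewrite mul0r.
rewrite mulr_ge0// subr_ge0.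
have := @offspring_coins_le _ y z 0 f n bf ndf.
rewrite addn0 (_ : (fun v => f (v + 0)%N) = f); last first.
  by apply/funext => v; rewrite addn0.
by apply; rewrite ?size_tuple// => k; rewrite addn0; exact: mu_le.
Qed.

Lemma joint_offspring_le f n : bounded_seq f -> nondecr f ->
  offspring p f n <= offspring q f n.
Proof.
move=> bf ndf; rewrite -subr_ge0 joint_offspring//; apply: sumr_ge0 => -[y z] _.
exact: joint_term_ge0.
Qed.

Lemma joint_offspring_gap y z k f : bounded_seq f -> nondecr f ->
  (count id (take k y) < count id (take k z))%N ->
  mu y z * (f (count id (take k y)).+1 - f (count id (take k y))) <=
  offspring q f (count negb (take k y)) - offspring p f (count negb (take k y)).
Proof.
move=> bf ndf yz; rewrite joint_offspring// (bigD1 (y, z))//= ler_wpDr//.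
  by apply: sumr_ge0 => -[y' z'] _; exact: joint_term_ge0.
by rewrite ler_wpM2l// offspring_coins_lt// !size_tuple.
Qed.

End joint_domination.

Lemma ex_elliptic (R : realType) (M : nat) (p q : M.-tuple R) :
  cookie_env p -> cookie_env q ->
  exists e : R, [/\ 0 < e, e <= 2^-1, elliptic e p & elliptic e q].
Proof.
have one (r : M.-tuple R) : cookie_env r ->
    exists2 e : R, 0 < e & elliptic e r.
  move=> hr; have : all (fun a => 0 < a < 1) r.
    by apply/allP => a /tnthP[j ->]; exact: hr.
  elim: (val r) => [|a s IH /= /andP[/andP[a0 a1] /IH[e e0 es]]]; first by exists 1.
  exists (Num.min e (Num.min a (1 - a))).
    by rewrite !lt_min e0 a0 subr_gt0.
  have m1 : Num.min e (Num.min a (1 - a)) <= e by rewrite ge_min lexx.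
  have m2 : Num.min e (Num.min a (1 - a)) <= a by rewrite !ge_min lexx orbT.
  have m3 : Num.min e (Num.min a (1 - a)) <= 1 - a by rewrite !ge_min lexx !orbT.
  rewrite /= m2 lerBrDr addrC -lerBrDr m3 /=.
  by apply/allP => x /(allP es) /andP[? ?]; apply/andP; split; lra.
move=> /one[e e0 ep] /one[e' e'0 eq].
exists (Num.min 2^-1 (Num.min e e')).
have m1 : Num.min 2^-1 (Num.min e e') <= 2^-1 by rewrite ge_min lexx.
have m2 : Num.min 2^-1 (Num.min e e') <= e by rewrite !ge_min lexx orbT.
have m3 : Num.min 2^-1 (Num.min e e') <= e' by rewrite !ge_min lexx !orbT.
split=> //.
- by rewrite !lt_min e0 e'0 invr_gt0 ltr0n.
- by apply/allP => x /(allP ep) /andP[? ?]; apply/andP; split; lra.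
- by apply/allP => x /(allP eq) /andP[? ?]; apply/andP; split; lra.
Qed.

Theorem theorem1p8 (R : realType) (M : nat) (hM : (0 < M)%N)
  (p q : M.-tuple R) (hp : cookie_env p) (hq : cookie_env q)
  (hpq : env_lt p q) (hdrift : 1 < total_drift p)
  (d : measure_display) (T : measurableType d) (P : probability T R)
  (X : nat -> {RV P >-> int}) (hX : is_ERW p X)
  (d' : measure_display) (T' : measurableType d') (P' : probability T' R)
  (X' : nat -> {RV P' >-> int}) (hX' : is_ERW q X') :
  (P [set w | forall n : nat, (0 < n)%N -> (0 < X n w)%R] <
   P' [set w | forall n : nat, (0 < n)%N -> (0 < X' n w)%R])%E.
Proof.
have [mu [mu0 mu_p mu_q mu_le [y [z [k [mu_yz yz]]]]]] := env_lt_joint hp hq hpq.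
have [e [e0 eh ep eq]] := ex_elliptic hp hq.
have p01 := elliptic_in01 (ltW e0) ep; have q01 := elliptic_in01 (ltW e0) eq.
have dom f n := @joint_offspring_le R M p q mu mu0 mu_p mu_q mu_le f n.
have driftp : 1 < \sum_(a <- p) (2 * a - 1).
  by rewrite big_tuple.
have [kappa kappa0 gap] := surv_gap e0 eh ep eq driftp dom mu_yz
  (fun f bf ndf => joint_offspring_gap mu0 mu_p mu_q mu_le bf ndf yz).
pose c0 j := nat_of_bool (j == 0)%N.
set p1 : R := nth 2^-1 p 0; set q1 : R := nth 2^-1 q 0.
have p1_gt0 : 0 < p1.
  by have /andP[? _] := elliptic_nth 0 eh ep; rewrite (lt_le_trans e0).
(* The first cookie is the one-generation survival probability. *)
have le_pq : p1 <= q1.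
  rewrite /p1 /q1 -!surv_once; apply: dom; first exact: (bounded_surv 0 p01).
  exact: (nondecr_surv 0 p01).
have c00 j : (0 < j)%N -> c0 j = 0%N by case: j.
have finP := fin_num_measure P _ (measurable_never_return X).
rewrite -(fineK finP); set Q := fine _.
(* Let the number of steps tend to infinity in a fixed window. *)
have ub r : Q <= p1 * surv p r 1.
  rewrite -(escape_start p r c00).
  set S := escape _ _ _ _ _ _; set C : R := (2 / e) ^+ r.+1 - (2 / e) ^+ 1.
  set rho : R := 1 - (2 / e) ^- r.+1.
  have rho_lt1 : `|rho| < 1.
    have L1 : 1 <= (2 / e) ^+ r.+1.
      by rewrite exprn_ege1// ler_pdivlMr// mul1r (le_trans eh)//; lra.
    have i0 : 0 < (2 / e) ^- r.+1 by rewrite invr_gt0 (lt_le_trans ltr01).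
    have i1 : (2 / e) ^- r.+1 <= 1 by rewrite invf_le1// (lt_le_trans ltr01).
    by rewrite /rho ger0_norm ?subr_ge0// gtrBl.
  have lim : (fun n => p1 * (S + rho ^+ n * C)) @ \oo --> p1 * (S + 0 * C).
    apply: cvgMr; apply: cvgD; first exact: cvg_cst.
    by apply: cvgMl; exact: cvg_expr.
  rewrite -[S]addr0 -[X in S + X](mul0r C) -(cvg_lim _ lim)//.
  apply: limr_ge; first exact/cvg_ex/ex_intro/lim.
  apply: nearW => n; rewrite -lee_fin /Q fineK//.
  apply: (le_trans (never_return_ub hX n)); rewrite lee_fin ler_wpM2l ?(ltW p1_gt0)//.
  exact: stay_le_escape.
(* Here the window is chosen after n, so that n steps stay inside it. *)
have lb n : Q + p1 * kappa <= q1 * stay_pos q n 1 c0.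
  apply: (@le_trans _ _ (q1 * surv q n.+4 1)); last first.
    rewrite ler_wpM2l ?(le_trans (ltW p1_gt0))// -(escape_start q n.+4 c00).
    by apply: escape_le_stay => //; rewrite add1n !ltnS; lia.
  apply: (@le_trans _ _ (p1 * surv q n.+4 1)).
    by apply: le_trans (ler_wpM2l (ltW p1_gt0) (gap n)); rewrite mulrDr lerD2r.
  by rewrite ler_wpM2r//; case/andP: (surv01 n.+4 1 q01).
apply: (lt_le_trans _ (never_return_lb hX' lb)).
by rewrite lte_fin ltrDl mulr_gt0.
Qed.
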